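(* Let $\gamma\in[0,1)$ and $\Omega_{\gamma}=\{z\in\mathbb{C}:|z+\frac{\gamma}{1-\gamma}|<\frac{1}{1-\gamma}\}$. Let $f=h+\overline{g}$ be a harmonic mapping in $\Omega_\gamma$ with $h,g$ analytic in $\Omega_\gamma$, $|h(z)|\le 1$ on $\Omega_\gamma$, $h(z)=\sum_{n=0}^\infty a_n\left(z+\frac{\gamma}{1-\gamma}\right)^n$ and $g(z)=\sum_{n=1}^\infty b_n\left(z+\frac{\gamma}{1-\gamma}\right)^n$ in $\Omega_\gamma$, and $|g'(z)|\le k|h'(z)|$ in $\Omega_\gamma$ for some $k\in[0,1)$. Then $$\sum_{n=0}^\infty \frac{|a_n|}{(1-\gamma)^n}\rho^n+\sum_{n=1}^\infty\frac{|b_n|}{(1-\gamma)^n}\rho^n\le 1$$ for $|(1-\gamma)z+\gamma|=\rho\le\rho_0=1/(2k+3)$. The number $\rho_0$ is best possible.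
   Context: $\Omega_\gamma$ is the open disk centered at $-\gamma/(1-\gamma)$ of radius $1/(1-\gamma)$. *)

(* Defs.v *)
From Stdlib Require Import Reals.
From Coquelicot Require Import Coquelicot.
Open Scope R_scope.

Definition cshift (gamma : R) : R := gamma / (1 - gamma).

Definition Omega (gamma : R) (z : C) : Prop :=
  Cmod (z + RtoC (cshift gamma))%C < 1 / (1 - gamma).

Definition is_Cderive (f : C -> C) (z l : C) : Prop :=
  @is_derive C_AbsRing C_NormedModule f z l.

Definition holomorphic_on (D : C -> Prop) (f : C -> C) : Prop :=
  forall z, D z -> exists l, is_Cderive f z l.

(* The hypotheses of the theorem on (h, g) with coefficients (a, b);
   b 0 is unused (the series of g starts at n = 1). *)
Definition admissible (gamma k : R) (h g : C -> C) (a b : nat -> C) : Prop :=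
  holomorphic_on (Omega gamma) h /\
  holomorphic_on (Omega gamma) g /\
  (forall z, Omega gamma z -> Cmod (h z) <= 1) /\
  (forall z, Omega gamma z ->
     is_series (fun n => (a n * Cpow (z + RtoC (cshift gamma)) n)%C) (h z)) /\
  (forall z, Omega gamma z ->
     is_series (fun n => (b (S n) * Cpow (z + RtoC (cshift gamma)) (S n))%C) (g z)) /\
  (forall z dh dg, Omega gamma z -> is_Cderive h z dh -> is_Cderive g z dg ->
     Cmod dg <= k * Cmod dh).

Definition bohr_ineq (gamma rho : R) (a b : nat -> C) : Prop :=
  ex_series (fun n => Cmod (a n) / (1 - gamma) ^ n * rho ^ n) /\
  ex_series (fun n => Cmod (b (S n)) / (1 - gamma) ^ (S n) * rho ^ (S n)) /\
  Series (fun n => Cmod (a n) / (1 - gamma) ^ n * rho ^ n)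
  + Series (fun n => Cmod (b (S n)) / (1 - gamma) ^ (S n) * rho ^ (S n)) <= 1.

(* Main.v *)
(** After rescaling to the unit disk, two facts about the power series of h and g
    suffice.  First, |h| <= 1 gives |a_n| <= 1 - |a_0|^2: multiplication by h is a
    contraction in the H^2 norm, and this is tested on polynomials x + y z^n.
    Second, comparing the quadratic means of |g'| <= k |h'| on circles and
    integrating twice in the squared radius gives
    sum |b_n|^2 t^n <= k^2 sum_(n >= 1) |a_n|^2 t^n, so no division by the zeros of
    h' is needed.  By Cauchy-Schwarz the Bohr sum is then at most
    |a_0| + (1 + k) (1 - |a_0|^2) rho / (1 - rho), which is at most 1 for
    rho <= 1 / (2k + 3).  Parseval's identity is obtained without integration, by
    averaging over the solutions of z^(2^m) = 1.  Sharpness comes from the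
    Moebius maps h(w) = (p - w) / (1 - p w), g = k (h - p), as p tends to 1. *)

Require Import Defs.
From Stdlib Require Import Reals Lra Lia Psatz.
From Coquelicot Require Import Coquelicot.
Open Scope R_scope.

(** * Finite sums, nonnegative series and complex series *)

Fixpoint Csum (c : nat -> C) (n : nat) : C :=
  match n with O => RtoC 0 | S m => (Csum c m + c m)%C end.

Fixpoint Rsum (c : nat -> R) (n : nat) : R :=
  match n with O => 0 | S m => Rsum c m + c m end.

Lemma sum_n_Csum (c : nat -> C) (n : nat) :
  sum_n (G := C_AbelianMonoid) c n = Csum c (S n).
Proof.
induction n as [|n IH].
- rewrite sum_O. simpl. ring.
- rewrite sum_Sn, IH. reflexivity.
Qed.

Lemma sum_n_Rsum (c : nat -> R) (n : nat) : sum_n c n = Rsum c (S n).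
Proof.
induction n as [|n IH].
- rewrite sum_O. simpl. ring.
- rewrite sum_Sn, IH. reflexivity.
Qed.

Lemma Csum_ext (c d : nat -> C) (n : nat) :
  (forall i, c i = d i) -> Csum c n = Csum d n.
Proof. intros H; induction n as [|n IH]; simpl; [|rewrite IH, H]; reflexivity. Qed.

Lemma Csum_scal (x : C) (c : nat -> C) (n : nat) :
  Csum (fun i => (x * c i)%C) n = (x * Csum c n)%C.
Proof. induction n as [|n IH]; simpl; [|rewrite IH]; ring. Qed.

Lemma Rsum_le (c d : nat -> R) (n : nat) :
  (forall i, c i <= d i) -> Rsum c n <= Rsum d n.
Proof.
intros H; induction n as [|n IH]; simpl; [lra|]. specialize (H n); lra.
Qed.

Lemma Rsum_ext (c d : nat -> R) (n : nat) :
  (forall i, c i = d i) -> Rsum c n = Rsum d n.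
Proof. intros H; induction n as [|n IH]; simpl; [|rewrite IH, H]; reflexivity. Qed.

Lemma Rsum_mono (c : nat -> R) (n m : nat) :
  (forall i, 0 <= c i) -> (n <= m)%nat -> Rsum c n <= Rsum c m.
Proof.
intros H; induction 1 as [|m _ IH]; simpl; [lra|]. specialize (H m); lra.
Qed.

Lemma Cmod_Csum_le (c : nat -> C) (n : nat) :
  Cmod (Csum c n) <= Rsum (fun i => Cmod (c i)) n.
Proof.
induction n as [|n IH]; simpl; [rewrite Cmod_0; lra|].
eapply Rle_trans; [apply Cmod_triangle|lra].
Qed.

Lemma Cmod_Csum_sub_le (c : nat -> C) (n m : nat) : (n <= m)%nat ->
  Cmod (Csum c m - Csum c n) <=
  Rsum (fun i => Cmod (c i)) m - Rsum (fun i => Cmod (c i)) n.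
Proof.
induction 1 as [|m _ IH]; simpl.
- replace (Csum c n - Csum c n)%C with (RtoC 0) by ring. rewrite Cmod_0; lra.
- replace (Csum c m + c m - Csum c n)%C with (Csum c m - Csum c n + c m)%C by ring.
  eapply Rle_trans; [apply Cmod_triangle|lra].
Qed.

Lemma is_lim_seq_Rsum (c : nat -> R) :
  ex_series c -> is_lim_seq (Rsum c) (Series c).
Proof.
intros H. apply Series_correct in H.
apply is_lim_seq_incr_1.
apply is_lim_seq_ext with (2 := H). apply sum_n_Rsum.
Qed.

Lemma Rsum_le_Series (c : nat -> R) (n : nat) :
  (forall i, 0 <= c i) -> ex_series c -> Rsum c n <= Series c.
Proof.
intros Hp H.
apply (is_lim_seq_le_loc (fun _ => Rsum c n) (Rsum c) (Rsum c n) (Series c)).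
- exists n; intros m Hm; now apply Rsum_mono.
- apply is_lim_seq_const.
- now apply is_lim_seq_Rsum.
Qed.

Lemma Series_le_bound (c : nat -> R) (M : R) :
  ex_series c -> (forall n, Rsum c n <= M) -> Series c <= M.
Proof.
intros H Hn.
apply (is_lim_seq_le (Rsum c) (fun _ => M) (Series c) M); trivial.
- now apply is_lim_seq_Rsum.
- apply is_lim_seq_const.
Qed.

(** Turns convergence in [C_NormedModule] into a real limit of moduli, so that order and limit
    theorems for real sequences apply. Taking [x = l] recovers convergence itself; taking a partial
    sum for [x] gives tail estimates. *)
Lemma Cseries_lim_norm (c : nat -> C) (l x : C) :
  is_series (V := C_NormedModule) c l ->
  is_lim_seq (fun n => Cmod (Csum c n - x)) (Cmod (l - x)).
Proof.
intros H.
apply is_lim_seq_incr_1.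
apply is_lim_seq_ext with (fun n => norm (minus (sum_n c n) x : C_NormedModule)).
{ intros n. now rewrite <- sum_n_Csum. }
apply (filterlim_comp _ _ _ (fun n => (minus (sum_n c n) x : C_NormedModule))
  (@norm C_AbsRing C_NormedModule) _ (locally (minus l x : C_NormedModule))).
- apply (filterlim_comp_2 (G := locally (l : C_NormedModule))
    (H := locally (opp x : C_NormedModule)) (sum_n c)
    (fun _ => opp x : C_NormedModule) plus).
  + exact H.
  + apply filterlim_const.
  + exact (filterlim_plus (V := C_NormedModule) l (opp x)).
- apply (filterlim_norm (V := C_NormedModule)).
Qed.

Lemma Cseries_of_lim (c : nat -> C) (l : C) :
  is_lim_seq (fun n => Cmod (Csum c n - l)) 0 ->
  is_series (V := C_NormedModule) c l.
Proof.
intros H. apply is_lim_seq_incr_1 in H. unfold is_series.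
apply filterlim_locally_ball_norm.
intros eps.
apply is_lim_seq_spec in H. destruct (H eps) as [N HN].
exists N; intros n Hn. specialize (HN n Hn).
rewrite Rminus_0_r, Rabs_pos_eq in HN by apply Cmod_ge_0.
rewrite <- sum_n_Csum in HN. exact HN.
Qed.

Lemma Cseries_tail (c : nat -> C) (l : C) (n : nat) :
  ex_series (fun i => Cmod (c i)) -> is_series (V := C_NormedModule) c l ->
  Cmod (l - Csum c n) <=
  Series (fun i => Cmod (c i)) - Rsum (fun i => Cmod (c i)) n.
Proof.
intros Ha Hl.
apply (is_lim_seq_le_loc (fun m => Cmod (Csum c m - Csum c n))
  (fun m => Rsum (fun i => Cmod (c i)) m - Rsum (fun i => Cmod (c i)) n)
  (Cmod (l - Csum c n))
  (Series (fun i => Cmod (c i)) - Rsum (fun i => Cmod (c i)) n)).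
- exists n; intros m Hm; now apply Cmod_Csum_sub_le.
- now apply Cseries_lim_norm.
- apply is_lim_seq_minus'; [now apply is_lim_seq_Rsum|apply is_lim_seq_const].
Qed.

Lemma Cseries_abs_conv (c : nat -> C) :
  ex_series (fun i => Cmod (c i)) ->
  exists l, is_series (V := C_NormedModule) c l.
Proof.
intros H.
exact (ex_series_le (V := C_CompleteNormedModule) c _ (fun n => Rle_refl _) H).
Qed.

(** * Parseval's identity from means over roots of unity *)

(** The half-angle formulas: for [v] on the unit circle this is the square root with nonnegative
    real part. *)
Definition Csqrt1 (v : C) : C :=
  (sqrt ((1 + Re v) / 2),
   if Rle_dec 0 (Im v) then sqrt ((1 - Re v) / 2) else - sqrt ((1 - Re v) / 2)).

Lemma Csqrt1_sq (v : C) : Cmod v = 1 -> (Csqrt1 v * Csqrt1 v)%C = v.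
Proof.
intros H. pose proof (Cmod2_alt v) as E. rewrite H in E.
destruct v as [x y]. unfold Csqrt1, Re, Im in *; simpl in *.
assert (Hx : -1 <= x <= 1) by nra.
assert (Hp : 0 <= (1 + x) / 2) by lra. assert (Hm : 0 <= (1 - x) / 2) by lra.
pose proof (sqrt_sqrt _ Hp). pose proof (sqrt_sqrt _ Hm).
(* The product is the root of [(1 - x^2) / 4], and [1 - x^2 = y^2] on the circle. The branch chosen
   by the sign of [y] removes the absolute value. *)
assert (P : sqrt ((1 + x) / 2) * sqrt ((1 - x) / 2) = Rabs y / 2).
{ rewrite <- sqrt_mult by assumption.
  replace ((1 + x) / 2 * ((1 - x) / 2)) with (Rsqr (y / 2)) by (unfold Rsqr; nra).
  rewrite sqrt_Rsqr_abs. unfold Rdiv. rewrite Rabs_mult.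
  rewrite (Rabs_pos_eq (/ 2)) by lra. reflexivity. }
unfold Cmult; simpl. destruct (Rle_dec 0 y) as [h|h].
- rewrite Rabs_pos_eq in P by assumption. f_equal; lra.
- rewrite Rabs_left in P by lra. f_equal; lra.
Qed.

Lemma Csqrt1_mod (v : C) : Cmod v = 1 -> Cmod (Csqrt1 v) = 1.
Proof.
intros H. pose proof (Csqrt1_sq v H) as E. apply (f_equal Cmod) in E.
rewrite Cmod_mult, H in E. pose proof (Cmod_ge_0 (Csqrt1 v)). nra.
Qed.

(* The mean of [F] over the [2^m] solutions of [z^(2^m) = w]. *)
Fixpoint rmean (m : nat) (F : C -> R) (w : C) : R :=
  match m with
  | O => F w
  | S m => rmean m (fun v => (F (Csqrt1 v) + F (- Csqrt1 v)%C) / 2) w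
  end.

Lemma rmean_le (m : nat) (F G : C -> R) (w : C) : Cmod w = 1 ->
  (forall z, Cmod z = 1 -> F z <= G z) -> rmean m F w <= rmean m G w.
Proof.
revert F G; induction m as [|m IH]; intros F G Hw H; simpl; [now apply H|].
apply IH; trivial. intros v Hv.
pose proof (H (Csqrt1 v) (Csqrt1_mod v Hv)).
pose proof (H (- Csqrt1 v)%C (eq_trans (Cmod_opp _) (Csqrt1_mod v Hv))). lra.
Qed.

Lemma rmean_ext (m : nat) (F G : C -> R) (w : C) :
  (forall z, F z = G z) -> rmean m F w = rmean m G w.
Proof.
revert F G; induction m as [|m IH]; intros F G H; simpl; [apply H|].
apply IH; intros; now rewrite !H.
Qed.

Lemma rmean_plus (m : nat) (F G : C -> R) (w : C) :
  rmean m (fun z => F z + G z) w = rmean m F w + rmean m G w.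
Proof.
revert F G; induction m as [|m IH]; intros F G; simpl; [reflexivity|].
rewrite <- IH. apply rmean_ext; intros; lra.
Qed.

Lemma rmean_const (m : nat) (x : R) (w : C) : rmean m (fun _ => x) w = x.
Proof.
induction m as [|m IH]; simpl; [reflexivity|].
replace ((x + x) / 2) with x by lra. exact IH.
Qed.

Lemma Cmod_parallelogram (x y : C) :
  (Cmod (x + y) ^ 2 + Cmod (x - y) ^ 2) / 2 = Cmod x ^ 2 + Cmod y ^ 2.
Proof.
rewrite !Cmod2_alt. destruct x, y; unfold Re, Im; simpl. field.
Qed.

Lemma Csum_double (c : nat -> C) (n : nat) :
  Csum c (2 * n) = (Csum (fun i => c (2 * i)%nat) n
                   + Csum (fun i => c (2 * i + 1)%nat) n)%C.
Proof.
induction n as [|n IH]; [simpl; ring|].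
replace (2 * S n)%nat with (S (S (2 * n))) by lia.
cbn [Csum]. rewrite IH. replace (S (2 * n)) with (2 * n + 1)%nat by lia. ring.
Qed.

Lemma Rsum_double (c : nat -> R) (n : nat) :
  Rsum c (2 * n) = Rsum (fun i => c (2 * i)%nat) n
                   + Rsum (fun i => c (2 * i + 1)%nat) n.
Proof.
induction n as [|n IH]; [simpl; ring|].
replace (2 * S n)%nat with (S (S (2 * n))) by lia.
cbn [Rsum]. rewrite IH. replace (S (2 * n)) with (2 * n + 1)%nat by lia. ring.
Qed.

(* Splitting p(z) = e(z^2) + z o(z^2) and applying the parallelogram law halves
   the degree. *)
Lemma rmean_parseval (m : nat) (c : nat -> C) (w : C) : Cmod w = 1 ->
  rmean m (fun z => Cmod (Csum (fun n => c n * z ^ n)%C (2 ^ m)) ^ 2) w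
  = Rsum (fun n => Cmod (c n) ^ 2) (2 ^ m).
Proof.
intros Hw; revert c; induction m as [|m IH]; intros c.
{ simpl. rewrite Cplus_0_l, Cmult_1_r. ring. }
cbn [rmean]. rewrite Nat.pow_succ_r', Rsum_double.
rewrite <- (IH (fun i => c (2 * i)%nat)), <- (IH (fun i => c (2 * i + 1)%nat)).
rewrite <- rmean_plus.
assert (X : forall v, Cmod v = 1 ->
  (Cmod (Csum (fun n : nat => (c n * Csqrt1 v ^ n)%C) (2 * 2 ^ m)) ^ 2 +
   Cmod (Csum (fun n : nat => (c n * (- Csqrt1 v) ^ n)%C) (2 * 2 ^ m)) ^ 2) / 2
  = Cmod (Csum (fun n : nat => (c (2 * n)%nat * v ^ n)%C) (2 ^ m)) ^ 2 +
    Cmod (Csum (fun n : nat => (c (2 * n + 1)%nat * v ^ n)%C) (2 ^ m)) ^ 2).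
{ intros v Hv. set (s := Csqrt1 v).
  assert (Hs : (s * s)%C = v) by now apply Csqrt1_sq.
  assert (Hs1 : Cmod s = 1) by now apply Csqrt1_mod.
  set (e := Csum (fun n : nat => (c (2 * n)%nat * v ^ n)%C) (2 ^ m)).
  set (o := Csum (fun n : nat => (c (2 * n + 1)%nat * v ^ n)%C) (2 ^ m)).
  (* Both roots [s] and [-s] of [v] share the same even part [e] and odd part [o], which depend on
     [v] only. *)
  assert (Y : forall t : C, (t * t)%C = v ->
     Csum (fun n : nat => (c n * t ^ n)%C) (2 * 2 ^ m) = (e + t * o)%C).
  { intros t Ht. rewrite Csum_double. unfold o. rewrite <- Csum_scal.
    unfold e. f_equal; apply Csum_ext; intros i.
    - rewrite Cpow_mult_r. simpl (t ^ 2)%C. rewrite Cmult_1_r, Ht. reflexivity.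
    - rewrite Cpow_add_r, Cpow_mult_r, Cpow_1_r. simpl (t ^ 2)%C.
      rewrite Cmult_1_r, Ht. ring. }
  rewrite (Y s Hs), (Y (- s)%C) by (rewrite <- Hs; ring).
  replace (e + - s * o)%C with (e - s * o)%C by ring.
  rewrite Cmod_parallelogram, Cmod_mult, Hs1, Rmult_1_l. reflexivity. }
(* [X] holds only on the unit circle, so equality of the means comes from [rmean_le] in both
   directions. *)
apply Rle_antisym; apply rmean_le; trivial; intros v Hv; rewrite X by trivial; apply Rle_refl.
Qed.

Lemma pow2_ge (m : nat) : (m <= 2 ^ m)%nat.
Proof. pose proof (Nat.pow_gt_lin_r 2 m ltac:(lia)). lia. Qed.

(** For the truncations at degree [2 ^ m] the means over the roots of unity are exact sums of
    squares. Absolute summability makes the truncation errors uniform on the circle, so the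
    pointwise inequality survives up to an error that vanishes as [m] grows. Bounding all partial
    sums by [M] compares the sums of squares without first proving their convergence. *)
Lemma parseval_domination (c d : nat -> C) (F G : C -> C) :
  ex_series (fun n => Cmod (c n)) -> ex_series (fun n => Cmod (d n)) ->
  (forall z, Cmod z = 1 -> is_series (V := C_NormedModule) (fun n => c n * z ^ n)%C (F z)) ->
  (forall z, Cmod z = 1 -> is_series (V := C_NormedModule) (fun n => d n * z ^ n)%C (G z)) ->
  (forall z, Cmod z = 1 -> Cmod (F z) <= Cmod (G z)) ->
  forall (n : nat) (M : R), (forall N, Rsum (fun i => Cmod (d i) ^ 2) N <= M) ->
    Rsum (fun i => Cmod (c i) ^ 2) n <= M.
Proof.
intros Hc Hd HF HG Hle n M HM.
set (D := Series (fun i => Cmod (d i))).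
set (e := fun N => (Series (fun i => Cmod (c i)) - Rsum (fun i => Cmod (c i)) N)
                 + (D - Rsum (fun i => Cmod (d i)) N)).
assert (Ext : forall (a : nat -> C) z i, Cmod z = 1 -> Cmod (a i * z ^ i)%C = Cmod (a i)).
{ intros a z i Hz. now rewrite Cmod_mult, Cmod_pow, Hz, pow1, Rmult_1_r. }
assert (Tail : forall (a : nat -> C) l z N, Cmod z = 1 ->
   ex_series (fun i => Cmod (a i)) ->
   is_series (V := C_NormedModule) (fun n => a n * z ^ n)%C l ->
   Cmod (l - Csum (fun n => a n * z ^ n)%C N) <=
   Series (fun i => Cmod (a i)) - Rsum (fun i => Cmod (a i)) N).
{ intros a l z N Hz Ha Hl.
  rewrite <- (Series_ext _ _ (fun i => Ext a z i Hz)).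
  rewrite <- (Rsum_ext _ _ N (fun i => Ext a z i Hz)).
  apply Cseries_tail; trivial.
  apply ex_series_ext with (2 := Ha). intros i; now rewrite Ext. }
assert (He0 : forall N, 0 <= e N).
{ intros N. unfold e, D.
  pose proof (Rsum_le_Series _ N (fun i => Cmod_ge_0 (c i)) Hc).
  pose proof (Rsum_le_Series _ N (fun i => Cmod_ge_0 (d i)) Hd). lra. }
(* With [P], [Q] the two truncations, [|P| <= |Q| + e] and [|Q| <= D] give
   [|P|^2 <= |Q|^2 + e (2 D + e)]. *)
assert (Key : forall m, Rsum (fun i => Cmod (c i) ^ 2) (2 ^ m)
                <= M + e (2 ^ m)%nat * (2 * D + e (2 ^ m)%nat)).
{ intros m. set (N := (2 ^ m)%nat).
  assert (H1 : Cmod (RtoC 1) = 1) by apply Cmod_1.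
  unfold N; rewrite <- (rmean_parseval m c _ H1); fold N.
  apply Rle_trans with
    (rmean m (fun z => Cmod (Csum (fun n => d n * z ^ n)%C N) ^ 2 +
                       e N * (2 * D + e N)) 1).
  - apply rmean_le; trivial. intros z Hz.
    pose proof (Tail c (F z) z N Hz Hc (HF z Hz)) as T1.
    pose proof (Tail d (G z) z N Hz Hd (HG z Hz)) as T2.
    specialize (Hle z Hz).
    set (P := Csum (fun n => c n * z ^ n)%C N) in *.
    set (Q := Csum (fun n => d n * z ^ n)%C N) in *.
    assert (A1 : Cmod P <= Cmod (F z) + Cmod (F z - P)).
    { rewrite <- (Cmod_opp (F z - P)).
      eapply Rle_trans; [|apply Cmod_triangle]. right; f_equal; ring. }
    assert (A2 : Cmod (G z) <= Cmod Q + Cmod (G z - Q)).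
    { eapply Rle_trans; [|apply Cmod_triangle]. right; f_equal; ring. }
    assert (A3 : Cmod Q <= D).
    { eapply Rle_trans; [apply Cmod_Csum_le|]. cbv beta.
      rewrite (Rsum_ext _ _ N (fun i => Ext d z i Hz)).
      apply Rsum_le_Series; trivial. intros; apply Cmod_ge_0. }
    assert (A4 : Cmod P <= Cmod Q + e N) by (unfold e; fold D in T2; lra).
    pose proof (Cmod_ge_0 P). pose proof (Cmod_ge_0 Q). pose proof (He0 N). nra.
  - rewrite rmean_plus, rmean_const. unfold N; rewrite (rmean_parseval m d _ H1).
    specialize (HM (2 ^ m)%nat). lra. }
assert (Le : is_lim_seq e 0).
{ unfold e.
  replace 0 with ((Series (fun i => Cmod (c i)) - Series (fun i => Cmod (c i))) + (D - D))
    by ring.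
  apply is_lim_seq_plus'; apply is_lim_seq_minus'; try apply is_lim_seq_const;
    now apply is_lim_seq_Rsum. }
assert (Le2 : is_lim_seq (fun m => e (2 ^ m)%nat) 0).
{ apply is_lim_seq_subseq with (2 := Le).
  apply eventually_subseq. intros k. simpl. pose proof (pow2_ge k).
  pose proof (Nat.pow_nonzero 2 k). lia. }
apply (is_lim_seq_le_loc (fun _ => Rsum (fun i => Cmod (c i) ^ 2) n)
  (fun m => M + e (2 ^ m)%nat * (2 * D + e (2 ^ m)%nat))
  (Rsum (fun i => Cmod (c i) ^ 2) n) M).
- exists n; intros m Hm. eapply Rle_trans; [|apply Key].
  apply Rsum_mono; [intros; apply pow2_ge_0|]. pose proof (pow2_ge m). lia.
- apply is_lim_seq_const.
- replace M with (M + 0 * (2 * D + 0)) at 1 by ring.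
  apply is_lim_seq_plus'; [apply is_lim_seq_const|].
  apply is_lim_seq_mult'; trivial.
  apply is_lim_seq_plus'; trivial. apply is_lim_seq_const.
Qed.

(** * Power series on a disk and their termwise derivatives *)

Lemma Cseries_ext (c d : nat -> C) (l : C) : (forall n, c n = d n) ->
  is_series (V := C_NormedModule) c l -> is_series (V := C_NormedModule) d l.
Proof. apply is_series_ext. Qed.

Lemma Cseries_scal (x : C) (c : nat -> C) (l : C) :
  is_series (V := C_NormedModule) c l ->
  is_series (V := C_NormedModule) (fun n => x * c n)%C (x * l)%C.
Proof. exact (is_series_scal (V := C_NormedModule) x c l). Qed.

Lemma Cseries_plus (c d : nat -> C) (l m : C) :
  is_series (V := C_NormedModule) c l -> is_series (V := C_NormedModule) d m ->
  is_series (V := C_NormedModule) (fun n => c n + d n)%C (l + m)%C.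
Proof. exact (is_series_plus (V := C_NormedModule) c d l m). Qed.

Lemma Cseries_norm_le (c : nat -> C) (b : nat -> R) (l : C) :
  (forall n, Cmod (c n) <= b n) -> ex_series b ->
  is_series (V := C_NormedModule) c l -> Cmod l <= Series b.
Proof.
intros H Hb Hl.
assert (Ha : ex_series (fun n => Cmod (c n))).
{ apply (ex_series_le (V := R_CompleteNormedModule) _ b); trivial.
  intros n. change (Rabs (Cmod (c n)) <= b n).
  rewrite Rabs_pos_eq by apply Cmod_ge_0. apply H. }
pose proof (Cseries_tail c l 0 Ha Hl) as T. simpl in T.
replace (l - 0)%C with l in T by ring.
assert (Series (fun n => Cmod (c n)) <= Series b); [|lra].
apply Series_le; trivial. intros n; split; [apply Cmod_ge_0|apply H].
Qed.

Lemma ex_series_nonneg_le (a b : nat -> R) :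
  (forall n, 0 <= a n <= b n) -> ex_series b -> ex_series a.
Proof.
intros H. apply (ex_series_le (V := R_CompleteNormedModule) a b).
intros n. change (Rabs (a n) <= b n). rewrite Rabs_pos_eq; apply H.
Qed.

Definition Cpseries_on (r : R) (c : nat -> C) (f : C -> C) : Prop :=
  forall u, Cmod u < r -> is_series (V := C_NormedModule) (fun n => c n * u ^ n)%C (f u).

(** At a real point [s] strictly between [t] and [r] the series converges, so its partial sums are
    bounded by some [M]; each term is a difference of consecutive partial sums, hence at most
    [M + M]. Bounded terms at [s] give radius at least [s]. *)
Lemma Cpseries_CV_radius (r t : R) (c : nat -> C) (f : C -> C) :
  Cpseries_on r c f -> 0 <= t < r -> Rbar_lt t (CV_radius (fun n => Cmod (c n))).
Proof.
intros H Ht. set (s := (t + r) / 2).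
assert (Hs : Cmod (RtoC s) = s) by (rewrite Cmod_R, Rabs_pos_eq; unfold s; lra).
assert (Hsr : Cmod (RtoC s) < r) by (rewrite Hs; unfold s; lra).
specialize (H _ Hsr).
destruct (filterlim_bounded (V := C_NormedModule) _ (ex_intro _ _ H)) as [M HM].
assert (HM' : forall n, Cmod (Csum (fun n => c n * RtoC s ^ n)%C n) <= M).
{ intros [|n].
  - simpl. rewrite Cmod_0. eapply Rle_trans; [|apply (HM 0%nat)].
    apply (norm_ge_0 (V := C_NormedModule)).
  - rewrite <- sum_n_Csum. apply HM. }
clear HM.
apply Rbar_lt_le_trans with s; [unfold s; simpl; lra|].
apply (proj1 (CV_radius_bounded _)). exists (M + M); intros n.
assert (HM : Cmod (c n * RtoC s ^ n)%C <= M + M).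
{ replace (c n * RtoC s ^ n)%C with
    (Csum (fun n => c n * RtoC s ^ n)%C (S n) + - Csum (fun n => c n * RtoC s ^ n)%C n)%C
    by (simpl; ring).
  eapply Rle_trans; [apply Cmod_triangle|]. rewrite Cmod_opp.
  apply Rplus_le_compat; apply HM'. }
rewrite Cmod_mult, Cmod_pow, Hs in HM.
rewrite Rabs_pos_eq; trivial.
apply Rmult_le_pos; [apply Cmod_ge_0|apply pow_le; unfold s; lra].
Qed.

Lemma ex_series_CV (a : nat -> R) (t : R) : 0 <= t ->
  Rbar_lt t (CV_radius a) -> ex_series (fun n => a n * t ^ n).
Proof.
intros Ht H. rewrite <- (Rabs_pos_eq t Ht) in H. apply CV_radius_inside in H.
apply ex_series_ext with (2 := H). intros n.
change (pow_n t n * a n = a n * t ^ n). rewrite pow_n_pow. ring.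
Qed.

Lemma Cpseries_abs (r t : R) (c : nat -> C) (f : C -> C) :
  Cpseries_on r c f -> 0 <= t < r -> ex_series (fun n => Cmod (c n) * t ^ n).
Proof.
intros H Ht. apply (ex_series_CV (fun n => Cmod (c n))); [tauto|].
now apply Cpseries_CV_radius with r f.
Qed.

(** Induction on the remainder: [R_(N+1) = v R_N + N u^(N-1) (v - u)^2], and
    [N (N-1) + N <= (N+1) N]. The constant is that of the second formal derivative. For [n = 0] and
    [n = 1] the truncated exponents are harmless because the factor [INR n * INR (n - 1)]
    vanishes. *)
Lemma Cpow_taylor1_le (u v : C) (t : R) (n : nat) :
  0 <= t -> Cmod u <= t -> Cmod v <= t ->
  Cmod (v ^ n - u ^ n - INR n * u ^ (n - 1) * (v - u)) <=
  INR n * INR (n - 1) * t ^ (n - 2) * Cmod (v - u) ^ 2.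
Proof.
intros Ht Hu Hv. destruct n as [|[|n]].
- simpl. match goal with |- Cmod ?x <= _ => replace x with (RtoC 0) by ring end.
  rewrite Cmod_0; lra.
- simpl. match goal with |- Cmod ?x <= _ => replace x with (RtoC 0) by ring end.
  rewrite Cmod_0; lra.
- replace (S (S n) - 2)%nat with n by lia. replace (S (S n) - 1)%nat with (S n) by lia.
  induction n as [|n IH].
  + replace (v ^ 2 - u ^ 2 - INR 2 * u ^ 1 * (v - u))%C with ((v - u) * (v - u))%C
      by (rewrite S_INR, RtoC_plus; simpl; ring).
    rewrite Cmod_mult. simpl. pose proof (Cmod_ge_0 (v - u)). nra.
  + replace (v ^ S (S (S n)) - u ^ S (S (S n)) - INR (S (S (S n))) * u ^ S (S n) * (v - u))%C
      with (v * (v ^ S (S n) - u ^ S (S n) - INR (S (S n)) * u ^ S n * (v - u))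
            + INR (S (S n)) * (u ^ S n * ((v - u) * (v - u))))%C.
    2:{ rewrite (S_INR (S (S n))), RtoC_plus. cbn [Cpow]. ring. }
    eapply Rle_trans; [apply Cmod_triangle|].
    rewrite !Cmod_mult, Cmod_R, Cmod_pow, (Rabs_pos_eq (INR _)) by apply pos_INR.
    set (d := Cmod (v - u)) in *. set (q := Cmod (_ - _ - _)) in *.
    assert (0 <= d) by apply Cmod_ge_0. assert (0 <= q) by apply Cmod_ge_0.
    assert (Hp : Cmod u ^ S n <= t ^ S n) by (apply pow_incr; split; [apply Cmod_ge_0|trivial]).
    assert (0 <= t ^ n) by now apply pow_le. assert (0 <= t ^ S n) by now apply pow_le.
    pose proof (pos_INR n). pose proof (Cmod_ge_0 v).
    rewrite !(S_INR (S n)), !(S_INR n) in *. rewrite (S_INR (S (S n))), (S_INR (S n)), (S_INR n) in *.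
    assert (A : Cmod v * q <= t * ((INR n + 1 + 1) * (INR n + 1) * t ^ n * d ^ 2)) by nra.
    assert (B : Cmod u ^ S n * (d * d) <= t ^ S n * (d * d)).
    { apply Rmult_le_compat_r; nra. }
    assert (B' : (INR n + 1 + 1) * (Cmod u ^ S n * (d * d)) <= (INR n + 1 + 1) * (t ^ S n * (d * d))).
    { apply Rmult_le_compat_l; lra. }
    replace (t * ((INR n + 1 + 1) * (INR n + 1) * t ^ n * d ^ 2)) with
      ((INR n + 1 + 1) * (INR n + 1) * (t ^ S n * (d * d))) in A by (simpl; ring).
    assert (0 <= t ^ S n * (d * d)) by (apply Rmult_le_pos; nra).
    replace (d ^ 2) with (d * d) by ring.
    nra.
Qed.

(** Summing the Taylor estimate termwise bounds the first-order remainder by [K |y - z|^2], with [K]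
    the second formal derivative of the series of moduli at some [t < r]. The shift [s] lets the
    lemma serve both the disk [Omega] and a disk centered at 0. *)
Lemma is_Cderive_Cpseries (s : C) (r : R) (c : nat -> C) (f h : C -> C) (z l : C) :
  Cpseries_on r c f -> (forall y, Cmod (y + s) < r -> h y = f (y + s)%C) ->
  Cmod (z + s) < r ->
  is_series (V := C_NormedModule) (fun n => (INR (S n) * c (S n)) * (z + s) ^ n)%C l ->
  is_Cderive h z l.
Proof.
intros Hf Hh Hz Hl. set (u := (z + s)%C) in *.
set (t := (Cmod u + r) / 2). pose proof (Cmod_ge_0 u) as Hu.
assert (Ht : 0 <= t < r) by (unfold t; lra).
set (B := fun n => Cmod (c n) * (INR n * INR (n - 1) * t ^ (n - 2))).
assert (HB : ex_series B).
{ apply ex_series_incr_1, ex_series_incr_1.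
  pose proof (Cpseries_CV_radius r t c f Hf Ht) as HC.
  rewrite <- CV_radius_derive, <- CV_radius_derive in HC.
  apply ex_series_CV in HC; [|tauto].
  apply ex_series_ext with (2 := HC). intros n. unfold B, PS_derive.
  replace (S (S n) - 2)%nat with n by lia. replace (S (S n) - 1)%nat with (S n) by lia.
  match goal with |- _ = ?y =>
    change (@eq R (INR (S n) * (INR (S (S n)) * Cmod (c (S (S n)))) * t ^ n) y) end.
  ring. }
set (K := Series B).
(* Reindexed so that the derivative lines up with the terms of [f]; the added term at [n = 0] is 0
   because of the factor [INR 0]. *)
assert (Hl0 : is_series (V := C_NormedModule) (fun n => (INR n * c n) * u ^ (n - 1))%C l).
{ apply Cseries_of_lim. apply is_lim_seq_incr_1.
  pose proof (Cseries_lim_norm _ _ l Hl) as L.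
  replace (l - l)%C with (RtoC 0) in L by ring. rewrite Cmod_0 in L.
  apply is_lim_seq_ext with (2 := L). intros n. f_equal. f_equal.
  induction n as [|n IH]; [simpl; ring|].
  cbn [Csum] in *. rewrite IH.
  replace (S n - 1)%nat with n by lia. ring. }
assert (Q : forall y, Cmod (y + s) <= t ->
   Cmod (h y - h z - (y - z) * l) <= K * Cmod (y - z) ^ 2).
{ intros y Hy. rewrite !Hh by (unfold u in *; lra). fold u. set (v := (y + s)%C) in *.
  replace (y - z)%C with (v - u)%C by (unfold u, v; ring).
  rewrite Rmult_comm. unfold K. rewrite <- Series_scal_l.
  apply (Cseries_norm_le (fun n => c n * (v ^ n - u ^ n - INR n * u ^ (n - 1) * (v - u)))%C).
  - intros n. rewrite Cmod_mult. unfold B.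
    replace (Cmod (v - u) ^ 2 * (Cmod (c n) * (INR n * INR (n - 1) * t ^ (n - 2)))) with
      (Cmod (c n) * (INR n * INR (n - 1) * t ^ (n - 2) * Cmod (v - u) ^ 2)) by ring.
    apply Rmult_le_compat_l; [apply Cmod_ge_0|].
    apply Cpow_taylor1_le; unfold t in *; lra.
  - apply (ex_series_scal (V := R_NormedModule)). exact HB.
  - assert (S1 := Hf v ltac:(lra)). assert (S2 := Hf u Hz).
    apply (Cseries_scal (- (1))%C) in S2.
    pose proof (Cseries_scal (- (v - u))%C _ _ Hl0) as S3.
    pose proof (Cseries_plus _ _ _ _ (Cseries_plus _ _ _ _ S1 S2) S3) as S4.
    replace (f v - f u - (v - u) * l)%C with (f v + - (1) * f u + - (v - u) * l)%C by ring.
    refine (Cseries_ext _ _ _ _ S4). intros n; cbv beta. ring. }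
assert (HK : 0 <= K).
{ apply Rle_trans with (Rsum B 0); [simpl; lra|].
  apply Rsum_le_Series; trivial. intros n; unfold B.
  repeat apply Rmult_le_pos; try apply Cmod_ge_0; try apply pos_INR. apply pow_le; lra. }
split; [apply is_linear_scal_l|].
intros x Hx. rewrite <- (is_filter_lim_locally_unique _ _ Hx). clear x Hx.
intros eps.
(* The first bound keeps [y + s] in the disk of radius [t]; the second gives [K |y - z| <= eps],
   with [K + 1] as divisor in case [K = 0]. *)
assert (Hd : 0 < Rmin ((r - Cmod u) / 2) (eps / (K + 1))).
{ apply Rmin_pos; [lra|]. apply Rdiv_lt_0_compat; [apply eps|lra]. }
exists (mkposreal _ Hd). intros y Hy.
change (Cmod (y - z) < Rmin ((r - Cmod u) / 2) (eps / (K + 1))) in Hy.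
change (Cmod (h y - h z - (y - z) * l) <= eps * Cmod (y - z)).
pose proof (Rmin_l ((r - Cmod u) / 2) (eps / (K + 1))).
pose proof (Rmin_r ((r - Cmod u) / 2) (eps / (K + 1))).
eapply Rle_trans; [apply Q|].
- replace (y + s)%C with (u + (y - z))%C by (unfold u; ring).
  eapply Rle_trans; [apply Cmod_triangle|]. unfold t; lra.
- pose proof (Cmod_ge_0 (y - z)). pose proof (cond_pos eps).
  assert (K * Cmod (y - z) <= eps).
  { assert (E : (K + 1) * (eps / (K + 1)) = eps) by (field; lra).
    assert ((K + 1) * Cmod (y - z) <= (K + 1) * (eps / (K + 1))); [|nra].
    apply Rmult_le_compat_l; lra. }
  nra.
Qed.

(** * Coefficients of a power series bounded by 1 *)

(** Multiplication by [z ^ m], seen on coefficients. *)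
Definition Cshift_seq (m : nat) (c : nat -> C) (n : nat) : C :=
  if Nat.ltb n m then RtoC 0 else c (n - m)%nat.

Lemma Cshift_seq_lt (m n : nat) (c : nat -> C) : (n < m)%nat -> Cshift_seq m c n = 0.
Proof. intros H. unfold Cshift_seq. now rewrite (proj2 (Nat.ltb_lt n m) H). Qed.

Lemma Cshift_seq_ge (m n : nat) (c : nat -> C) : Cshift_seq m c (m + n) = c n.
Proof.
unfold Cshift_seq. rewrite (proj2 (Nat.ltb_ge (m + n) m)) by lia.
f_equal. lia.
Qed.

Lemma Cseries_shift (m : nat) (c : nat -> C) (z l : C) :
  is_series (V := C_NormedModule) (fun n => c n * z ^ n)%C l ->
  is_series (V := C_NormedModule) (fun n => Cshift_seq m c n * z ^ n)%C (z ^ m * l)%C.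
Proof.
intros H. apply Cseries_of_lim. apply (is_lim_seq_incr_n _ m).
pose proof (Cseries_lim_norm _ _ l H) as L.
replace (l - l)%C with (RtoC 0) in L by ring. rewrite Cmod_0 in L.
apply (is_lim_seq_scal_l _ (Cmod (z ^ m)%C)) in L.
simpl in L. rewrite Rmult_0_r in L.
apply is_lim_seq_ext with (2 := L). intros n. rewrite <- Cmod_mult. f_equal.
assert (E0 : forall k, (k <= m)%nat -> Csum (fun n => Cshift_seq m c n * z ^ n)%C k = 0).
{ induction k as [|k IH]; intros Hk; [reflexivity|].
  cbn [Csum]. rewrite IH, Cshift_seq_lt by lia. ring. }
assert (E : Csum (fun n => Cshift_seq m c n * z ^ n)%C (m + n) =
            (z ^ m * Csum (fun n => c n * z ^ n)%C n)%C).
{ clear L. induction n as [|n IH].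
  - rewrite Nat.add_0_r, E0 by lia. simpl; ring.
  - rewrite Nat.add_succ_r. cbn [Csum]. rewrite IH, Cshift_seq_ge, Cpow_add_r. ring. }
rewrite Nat.add_comm, E. ring.
Qed.

Lemma ex_series_Cshift_seq (m : nat) (c : nat -> C) :
  ex_series (fun n => Cmod (c n)) -> ex_series (fun n => Cmod (Cshift_seq m c n)).
Proof.
intros H. apply (ex_series_incr_n _ m).
apply ex_series_ext with (2 := H). intros n. now rewrite Cshift_seq_ge.
Qed.

Lemma ex_series_Cmod_lin (x y : C) (c d : nat -> C) :
  ex_series (fun n => Cmod (c n)) -> ex_series (fun n => Cmod (d n)) ->
  ex_series (fun n => Cmod (x * c n + y * d n)%C).
Proof.
intros Hc Hd.
apply ex_series_nonneg_le with (fun n => Cmod x * Cmod (c n) + Cmod y * Cmod (d n)).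
- intros n; split; [apply Cmod_ge_0|]. rewrite <- !Cmod_mult. apply Cmod_triangle.
- apply (ex_series_plus (V := R_NormedModule)); now apply (ex_series_scal (V := R_NormedModule)).
Qed.

Definition Cdelta (n : nat) : C := match n with O => RtoC 1 | S _ => RtoC 0 end.

Lemma is_series_Cdelta (z : C) :
  is_series (V := C_NormedModule) (fun n => Cdelta n * z ^ n)%C (RtoC 1).
Proof.
apply Cseries_of_lim. apply is_lim_seq_incr_1.
apply is_lim_seq_ext with (2 := is_lim_seq_const 0). intros n.
assert (E : Csum (fun n => Cdelta n * z ^ n)%C (S n) = 1).
{ induction n as [|n IH]; [simpl; ring|]. cbn [Csum] in *. rewrite IH. simpl; ring. }
rewrite E. replace (1 - 1)%C with (RtoC 0) by ring. now rewrite Cmod_0.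
Qed.

Lemma ex_series_Cdelta : ex_series (fun n => Cmod (Cdelta n)).
Proof.
apply ex_series_incr_1. exists 0.
apply is_lim_seq_ext with (2 := is_lim_seq_const 0). intros n.
rewrite sum_n_Rsum. simpl Cdelta. rewrite Cmod_0.
induction n as [|n IH]; simpl in *; lra.
Qed.

(* Multiplication by f is a contraction for the H^2 norm; tested on the
   polynomials x + y z^m. *)
Lemma bounded_coeff_contraction (r t : R) (c : nat -> C) (f : C -> C) (m : nat) (x y : C) :
  Cpseries_on r c f -> (forall u, Cmod u < r -> Cmod (f u) <= 1) ->
  0 <= t < r -> (0 < m)%nat ->
  Cmod (x * c 0%nat) ^ 2 + Cmod (x * (c m * t ^ m) + y * c 0%nat)%C ^ 2
  <= Cmod x ^ 2 + Cmod y ^ 2.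
Proof.
intros Hf Hb Ht Hm.
(* [a] belongs to the dilation [f (t z)], absolutely summable on the unit circle as [t < r]; [p]
   belongs to [(x + y z^m) f (t z)] and [q] to [x + y z^m]. *)
set (a := fun n => (c n * RtoC t ^ n)%C).
set (p := fun n => (x * a n + y * Cshift_seq m a n)%C).
set (q := fun n => (x * Cdelta n + y * Cshift_seq m Cdelta n)%C).
assert (Ha : ex_series (fun n => Cmod (a n))).
{ apply ex_series_ext with (2 := Cpseries_abs r t c f Hf Ht). intros n. unfold a.
  rewrite Cmod_mult, Cmod_pow, Cmod_R, Rabs_pos_eq; tauto. }
assert (Lin : forall (e : nat -> C) (z l : C),
  is_series (V := C_NormedModule) (fun n => e n * z ^ n)%C l ->
  is_series (V := C_NormedModule) (fun n => (x * e n + y * Cshift_seq m e n) * z ^ n)%C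
    ((x + y * z ^ m) * l)%C).
{ intros e z l He.
  replace ((x + y * z ^ m) * l)%C with (x * l + y * (z ^ m * l))%C by ring.
  eapply Cseries_ext; [|apply Cseries_plus; apply Cseries_scal;
    [exact He|exact (Cseries_shift m e z l He)]].
  intros n; cbv beta; ring. }
assert (Hq : forall N, Rsum (fun i => Cmod (q i) ^ 2) N <= Cmod x ^ 2 + Cmod y ^ 2).
{ assert (E : forall i, Cmod (q i) ^ 2 =
    (if Nat.eqb i 0 then Cmod x ^ 2 else 0) + (if Nat.eqb i m then Cmod y ^ 2 else 0)).
  { intros i. unfold q. destruct (Nat.lt_ge_cases i m) as [h|h].
    - rewrite Cshift_seq_lt by trivial. rewrite (proj2 (Nat.eqb_neq i m)) by lia.
      destruct i; simpl Cdelta; simpl Nat.eqb; cbv iota.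
      + replace (x * 1 + y * 0)%C with x by ring. ring.
      + replace (x * 0 + y * 0)%C with (RtoC 0) by ring. rewrite Cmod_0. ring.
    - replace i with (m + (i - m))%nat at 2 by lia. rewrite Cshift_seq_ge.
      destruct i as [|i]; [lia|]. simpl (Cdelta (S i)). simpl (Nat.eqb (S i) 0). cbv iota.
      destruct (Nat.eqb_spec (S i) m) as [E|E].
      + replace (S i - m)%nat with 0%nat by lia. simpl Cdelta.
        replace (x * 0 + y * 1)%C with y by ring. ring.
      + destruct (S i - m)%nat eqn:E'; [lia|]. simpl Cdelta.
        replace (x * 0 + y * 0)%C with (RtoC 0) by ring. rewrite Cmod_0. ring. }
  intros N.
  assert (X : forall j v,
     Rsum (fun i => if Nat.eqb i j then v else 0) N = if Nat.ltb j N then v else 0).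
  { clear. intros j v. induction N as [|N IH]; [reflexivity|]. cbn [Rsum]. rewrite IH.
    destruct (Nat.ltb_spec j N), (Nat.ltb_spec j (S N)), (Nat.eqb_spec N j); try lia; ring. }
  assert (X2 : Rsum (fun i => Cmod (q i) ^ 2) N =
     Rsum (fun i => if Nat.eqb i 0 then Cmod x ^ 2 else 0) N +
     Rsum (fun i => if Nat.eqb i m then Cmod y ^ 2 else 0) N).
  { clear X. induction N as [|N IH]; cbn [Rsum]; [ring|]. rewrite IH, E. ring. }
  pose proof (pow2_ge_0 (Cmod x)). pose proof (pow2_ge_0 (Cmod y)).
  rewrite X2, !X by trivial. destruct (Nat.ltb 0 N), (Nat.ltb m N); lra. }
assert (M : Rsum (fun i => Cmod (p i) ^ 2) (S m) <= Cmod x ^ 2 + Cmod y ^ 2).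
{ apply (parseval_domination p q (fun z => (x + y * z ^ m) * f (RtoC t * z))%C
    (fun z => (x + y * z ^ m) * 1)%C); trivial.
  - now apply ex_series_Cmod_lin; [|apply ex_series_Cshift_seq].
  - apply ex_series_Cmod_lin; [|apply ex_series_Cshift_seq]; apply ex_series_Cdelta.
  - intros z Hz. apply Lin.
    assert (Hz' : Cmod (RtoC t * z) < r)
      by (rewrite Cmod_mult, Hz, Cmod_R, Rabs_pos_eq; lra).
    refine (Cseries_ext _ _ _ _ (Hf _ Hz')). intros n. unfold a. cbv beta.
    rewrite Cpow_mult_l. ring.
  - intros z Hz. apply Lin. apply is_series_Cdelta.
  - intros z Hz. rewrite !Cmod_mult. apply Rmult_le_compat_l; [apply Cmod_ge_0|].
    rewrite Cmod_1. apply Hb. rewrite Cmod_mult, Hz, Cmod_R, Rabs_pos_eq; lra. }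
(* Among the indices up to [m] only 0 and [m] are kept; they are distinct since [0 < m]. *)
eapply Rle_trans; [|exact M]. cbn [Rsum].
apply Rplus_le_compat.
- eapply Rle_trans; [|apply (Rsum_mono _ 1); [intros; apply pow2_ge_0|exact Hm]].
  cbn [Rsum]. unfold p. rewrite Cshift_seq_lt by trivial. unfold a.
  right. rewrite Rplus_0_l. simpl (RtoC t ^ 0)%C.
  replace (x * (c 0%nat * 1) + y * 0)%C with (x * c 0%nat)%C by ring. reflexivity.
- pose proof (Cshift_seq_ge m 0 a) as E. rewrite Nat.add_0_r in E.
  right. f_equal. f_equal. unfold p. rewrite E. unfold a.
  simpl (RtoC t ^ 0)%C. ring.
Qed.

Lemma pow_bound_left_limit (r x y : R) (n : nat) : 0 < r ->
  (forall t, 0 <= t < r -> x * t ^ n <= y) -> x * r ^ n <= y.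
Proof.
intros Hr H.
apply (filterlim_le (F := at_left r) (fun t => x * t ^ n) (fun _ => y) (x * r ^ n) y).
- exists (mkposreal r Hr). intros t Ht Htr. apply H.
  change (Rabs (t - r) < r) in Ht. apply Rabs_def2 in Ht. lra.
- eapply filterlim_filter_le_1; [apply filter_le_within|].
  apply (ex_derive_continuous (fun t => x * t ^ n)). auto_derive. exact I.
- apply filterlim_const.
Qed.

(** The contraction inequality tested on the polynomial 1 gives [|c 0| <= 1]. A two-term test
    polynomial gives the second bound at every [t < r], and [t] then tends to [r]. *)
Lemma bounded_coeff_le (r : R) (c : nat -> C) (f : C -> C) (m : nat) :
  0 < r -> Cpseries_on r c f -> (forall u, Cmod u < r -> Cmod (f u) <= 1) ->
  (0 < m)%nat -> Cmod (c 0%nat) <= 1 /\ Cmod (c m) * r ^ m <= 1 - Cmod (c 0%nat) ^ 2.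
Proof.
intros Hr Hf Hb Hm.
set (a := Cmod (c 0%nat)). assert (Ha : 0 <= a) by apply Cmod_ge_0.
assert (H0 : a <= 1).
{ pose proof (bounded_coeff_contraction r 0 c f m 1 0 Hf Hb ltac:(lra) Hm) as B.
  rewrite Cmult_1_l, Cmod_1, Cmod_0 in B. fold a in B.
  pose proof (pow2_ge_0 (Cmod (1 * (c m * 0 ^ m) + 0 * c 0%nat)%C)). nra. }
split; trivial. apply pow_bound_left_limit; trivial. intros t Ht.
set (d := Cmod (c m) * t ^ m).
assert (Hd : 0 <= d) by (apply Rmult_le_pos; [apply Cmod_ge_0|apply pow_le; tauto]).
(* The test vector (s, conj(c_0) c_m t^m), for a real s. *)
assert (T : forall s, 0 <= s -> (s * a) ^ 2 + ((s + a ^ 2) * d) ^ 2 <= s ^ 2 + (a * d) ^ 2).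
{ intros s Hs.
  pose proof (bounded_coeff_contraction r t c f m s (Cconj (c 0%nat) * (c m * t ^ m))%C Hf Hb Ht Hm) as B.
  rewrite <- !RtoC_pow in B.
  assert (E : (s * (c m * (t ^ m)%R) + Cconj (c 0%nat) * (c m * (t ^ m)%R) * c 0%nat)%C
     = ((s + a ^ 2)%R * (c m * (t ^ m)%R))%C).
  { rewrite RtoC_plus. unfold a. rewrite Cmod2_conj. ring. }
  rewrite E in B. rewrite !Cmod_mult, Cmod_conj, !Cmod_R in B. fold a in B.
  rewrite (Rabs_pos_eq (t ^ m)) in B by (apply pow_le; tauto). fold d in B.
  rewrite !Rabs_pos_eq in B by nra. exact B. }
(* If [a < 1], then [s = 1 - a^2] makes [s + a^2 = 1] and [T] becomes
   [d^2 (1 - a^2) <= (1 - a^2)^3]. If [a = 1], then [s = 1] gives [4 d^2 <= d^2], so [d = 0]. *)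
destruct (Rle_lt_or_eq_dec _ _ H0) as [h|h].
- specialize (T (1 - a ^ 2) ltac:(nra)).
  assert (0 < 1 - a ^ 2) by nra.
  apply Rsqr_incr_0; [|trivial|lra]. unfold Rsqr.
  replace (1 - a ^ 2 + a ^ 2) with 1 in T by ring.
  apply Rmult_le_reg_l with (1 - a ^ 2); [trivial|]. nra.
- specialize (T 1 ltac:(lra)). rewrite h in T |- *. nra.
Qed.

(** * Comparison of the sums of squared coefficients of [g] and [h] *)

(** The function [x * PSeries e x] vanishes at 0 and has the given nonnegative series as derivative,
    so the mean value theorem makes it nonnegative at [t]; divide by [t]. At [t = 0] both series
    reduce to [e 0]. *)
Lemma PSeries_antiderivative_nonneg (e : nat -> R) (r t : R) :
  (forall x, 0 <= x < r -> Rbar_lt x (CV_radius e)) ->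
  (forall x, 0 <= x < r -> 0 <= PSeries (fun n => INR (S n) * e n) x) ->
  0 <= t < r -> 0 <= PSeries e t.
Proof.
intros HC H Ht.
destruct (Rle_lt_or_eq_dec _ _ (proj1 Ht)) as [h|h].
- assert (D : forall x, 0 <= x < r ->
    is_derive (PSeries (PS_incr_1 e)) x (PSeries (fun n => INR (S n) * e n) x)).
  { intros x Hx. apply (is_derive_PSeries (PS_incr_1 e)).
    rewrite CV_radius_incr_1, Rabs_pos_eq by tauto. now apply HC. }
  destruct (MVT_gen (PSeries (PS_incr_1 e)) 0 t (PSeries (fun n => INR (S n) * e n)))
    as [x [Hx E]].
  + rewrite Rmin_left, Rmax_right by lra. intros x Hx. apply D; lra.
  + rewrite Rmin_left, Rmax_right by lra. intros x Hx.
    apply continuity_pt_filterlim. apply (ex_derive_continuous (PSeries (PS_incr_1 e))).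
    eexists; apply D; lra.
  + rewrite Rmin_left, Rmax_right in Hx by lra.
    rewrite !PSeries_incr_1 in E. specialize (H x ltac:(lra)).
    apply Rmult_le_reg_l with t; [trivial|].
    rewrite Rmult_0_l, Rminus_0_r, Rminus_0_r in E.
    rewrite E, Rmult_0_r, Rmult_comm. apply Rmult_le_pos; lra.
- subst t. specialize (H 0 ltac:(lra)). rewrite PSeries_0 in *. simpl in H. lra.
Qed.

Lemma term_le_Series (a : nat -> R) (n : nat) :
  (forall i, 0 <= a i) -> ex_series a -> a n <= Series a.
Proof.
intros Hp H. pose proof (Rsum_le_Series a (S n) Hp H) as B. cbn [Rsum] in B.
pose proof (Rsum_mono a 0 n Hp (Nat.le_0_l n)). simpl in *. lra.
Qed.

Lemma ex_series_sq (a : nat -> R) :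
  (forall i, 0 <= a i) -> ex_series a -> ex_series (fun n => a n ^ 2).
Proof.
intros Hp H. apply ex_series_nonneg_le with (fun n => Series a * a n).
- intros n; split; [apply pow2_ge_0|].
  pose proof (term_le_Series a n Hp H). specialize (Hp n). simpl. nra.
- now apply (ex_series_scal (V := R_NormedModule)).
Qed.

Lemma Cpseries_derive_abs (r t : R) (c : nat -> C) (f : C -> C) :
  Cpseries_on r c f -> 0 <= t < r ->
  ex_series (fun n => INR (S n) * Cmod (c (S n)) * t ^ n).
Proof.
intros H Ht.
apply (ex_series_CV (PS_derive (fun n => Cmod (c n)))); [tauto|].
rewrite CV_radius_derive. now apply Cpseries_CV_radius with r f.
Qed.

Lemma Cpseries_derive_ex (r : R) (c : nat -> C) (f : C -> C) (u : C) :
  Cpseries_on r c f -> Cmod u < r ->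
  exists l, is_series (V := C_NormedModule) (fun n => (INR (S n) * c (S n)) * u ^ n)%C l.
Proof.
intros H Hu. apply Cseries_abs_conv.
apply ex_series_ext with (2 := Cpseries_derive_abs r (Cmod u) c f H (conj (Cmod_ge_0 u) Hu)).
intros n. now rewrite !Cmod_mult, Cmod_pow, Cmod_R, Rabs_pos_eq by apply pos_INR.
Qed.

(** Here the variable is the squared radius. For [sqrt x < s < r] the numbers [|c n| s^n] are
    bounded by [M], so the squared coefficients have bounded terms at [s^2]; the bound is
    [(M / s)^2] because of the index shift. *)
Lemma Cpseries_sq_CV_radius (r x : R) (c : nat -> C) (f : C -> C) :
  Cpseries_on r c f -> 0 <= x < r ^ 2 -> 0 < r ->
  Rbar_lt x (CV_radius (fun n => Cmod (c (S n)) ^ 2)).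
Proof.
intros H Hx Hr.
assert (Hs : sqrt x < r).
{ rewrite <- (sqrt_pow2 r) by lra. apply sqrt_lt_1; lra. }
pose proof (sqrt_pos x) as Hs0. pose proof (sqrt_sqrt x (proj1 Hx)) as Hss.
set (s := (sqrt x + r) / 2).
assert (Hsr : 0 < s < r) by (unfold s; lra).
pose proof (Cpseries_abs r s c f H ltac:(lra)) as HA.
set (M := Series (fun n => Cmod (c n) * s ^ n)) in *.
apply Rbar_lt_le_trans with (s ^ 2).
{ simpl. assert (sqrt x < s) by (unfold s; lra). nra. }
apply (proj1 (CV_radius_bounded _)). exists ((M / s) ^ 2). intros n.
rewrite Rabs_pos_eq.
2:{ apply Rmult_le_pos; [apply pow2_ge_0|apply pow_le, pow2_ge_0]. }
replace (Cmod (c (S n)) ^ 2 * (s ^ 2) ^ n) with ((Cmod (c (S n)) * s ^ n) ^ 2).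
2:{ rewrite Rpow_mult_distr, <- !pow_mult, (Nat.mul_comm n). reflexivity. }
apply pow_incr. split.
- apply Rmult_le_pos; [apply Cmod_ge_0|apply pow_le; lra].
- apply Rmult_le_reg_r with s; [lra|].
  replace (M / s * s) with M by (field; lra).
  replace (Cmod (c (S n)) * s ^ n * s) with (Cmod (c (S n)) * s ^ S n) by (simpl; ring).
  apply (term_le_Series (fun n => Cmod (c n) * s ^ n)); trivial.
  intros i. apply Rmult_le_pos; [apply Cmod_ge_0|apply pow_le; lra].
Qed.

(** Parseval's comparison for the derivatives on the circle of radius [s], written as a power series
    in [s^2]. The factor [INR (S n)] is kept twice, unmerged, so that two antiderivatives can remove
    one copy each. *)
Lemma derivative_parseval_le (r k s : R) (c d : nat -> C) (f g : C -> C) :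
  0 <= k -> Cpseries_on r c f -> Cpseries_on r d g ->
  (forall u F G, Cmod u < r ->
     is_series (V := C_NormedModule) (fun n => (INR (S n) * c (S n)) * u ^ n)%C F ->
     is_series (V := C_NormedModule) (fun n => (INR (S n) * d (S n)) * u ^ n)%C G ->
     Cmod G <= k * Cmod F) ->
  0 <= s < r ->
  0 <= PSeries (fun n => INR (S n) * (INR (S n) *
         (k ^ 2 * Cmod (c (S n)) ^ 2 - Cmod (d (S n)) ^ 2))) (s ^ 2).
Proof.
intros Hk Hf Hg Hle Hs.
set (p := fun n => (INR (S n) * d (S n) * RtoC s ^ n)%C).
set (q := fun n => (INR (S n) * c (S n) * RtoC s ^ n)%C).
assert (Abs : forall (c : nat -> C) f, Cpseries_on r c f ->
   ex_series (fun n => Cmod (INR (S n) * c (S n) * RtoC s ^ n)%C)).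
{ intros e F He.
  apply ex_series_ext with (2 := Cpseries_derive_abs r s e F He Hs). intros n.
  rewrite !Cmod_mult, Cmod_pow, !Cmod_R, !Rabs_pos_eq; trivial; [tauto|apply pos_INR]. }
pose proof (Abs d g Hg) as Hp. fold p in Hp. pose proof (Abs c f Hf) as Hq. fold q in Hq.
assert (Sp : ex_series (fun n => Cmod (p n) ^ 2)).
{ apply (ex_series_sq (fun n => Cmod (p n))); trivial. intros; apply Cmod_ge_0. }
assert (Sq : ex_series (fun n => Cmod (q n) ^ 2)).
{ apply (ex_series_sq (fun n => Cmod (q n))); trivial. intros; apply Cmod_ge_0. }
assert (Main : Series (fun n => Cmod (p n) ^ 2) <= k ^ 2 * Series (fun n => Cmod (q n) ^ 2)).
{ apply Series_le_bound; trivial. intros N.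
  (* [parseval_domination] needs the sum of the derived series as a function of [z]; [C_derive]
     supplies it, once the sum is known to be the derivative. *)
  assert (Lim : forall (e : nat -> C) (F : C -> C) z, Cpseries_on r e F -> Cmod z = 1 ->
     is_series (V := C_NormedModule) (fun n => (INR (S n) * e (S n) * RtoC s ^ n) * z ^ n)%C
       (C_derive F (RtoC s * z)%C) /\
     is_series (V := C_NormedModule) (fun n => (INR (S n) * e (S n)) * (RtoC s * z) ^ n)%C
       (C_derive F (RtoC s * z)%C)).
  { intros e F z He Hz.
    assert (Hu : Cmod (RtoC s * z) < r) by (rewrite Cmod_mult, Hz, Cmod_R, Rabs_pos_eq; lra).
    destruct (Cpseries_derive_ex r e F _ He Hu) as [l Hl].
    assert (D : is_Cderive F (RtoC s * z)%C l).
    { apply (is_Cderive_Cpseries 0 r e F F); trivial; rewrite ?Cplus_0_r; trivial.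
      intros y _. now rewrite Cplus_0_r. }
    apply is_C_derive_unique in D. rewrite D. split; trivial.
    refine (Cseries_ext _ _ _ _ Hl). intros n. cbv beta. rewrite Cpow_mult_l. ring. }
  apply (parseval_domination p (fun n => RtoC k * q n)%C
     (fun z => C_derive g (RtoC s * z)%C) (fun z => RtoC k * C_derive f (RtoC s * z))%C); trivial.
  - apply ex_series_ext with (fun n => k * Cmod (q n)).
    { intros n. rewrite Cmod_mult, Cmod_R, Rabs_pos_eq; trivial. }
    now apply (ex_series_scal (V := R_NormedModule)).
  - intros z Hz. exact (proj1 (Lim d g z Hg Hz)).
  - intros z Hz.
    refine (Cseries_ext _ _ _ _ (Cseries_scal k _ _ (proj1 (Lim c f z Hf Hz)))).
    intros n. unfold q. cbv beta. ring.
  - intros z Hz. rewrite Cmod_mult, Cmod_R, Rabs_pos_eq by trivial.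
    apply (Hle (RtoC s * z)%C).
    + rewrite Cmod_mult, Hz, Cmod_R, Rabs_pos_eq; lra.
    + exact (proj2 (Lim c f z Hf Hz)).
    + exact (proj2 (Lim d g z Hg Hz)).
  - intros n. rewrite <- Series_scal_l.
    eapply Rle_trans; [|apply (Rsum_le_Series (fun n => k ^ 2 * Cmod (q n) ^ 2) n)].
    + apply Rsum_le. intros i. right. rewrite Cmod_mult, Cmod_R, Rabs_pos_eq by trivial. ring.
    + intros i. apply Rmult_le_pos; apply pow2_ge_0.
    + now apply (ex_series_scal (V := R_NormedModule)). }
unfold PSeries.
rewrite (Series_ext _ (fun n => k ^ 2 * Cmod (q n) ^ 2 - Cmod (p n) ^ 2)).
- rewrite Series_minus, Series_scal_l; [lra| |trivial].
  now apply (ex_series_scal (V := R_NormedModule)).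
- intros n. unfold p, q.
  rewrite !Cmod_mult, Cmod_pow, !Cmod_R, (Rabs_pos_eq s), (Rabs_pos_eq (INR _))
    by (try tauto; apply pos_INR).
  rewrite !Rpow_mult_distr, <- !pow_mult, (Nat.mul_comm n). ring.
Qed.

Lemma coeff_sq_domination (r k t : R) (c d : nat -> C) (f g : C -> C) :
  0 < r -> 0 <= k -> Cpseries_on r c f -> Cpseries_on r d g ->
  (forall u F G, Cmod u < r ->
     is_series (V := C_NormedModule) (fun n => (INR (S n) * c (S n)) * u ^ n)%C F ->
     is_series (V := C_NormedModule) (fun n => (INR (S n) * d (S n)) * u ^ n)%C G ->
     Cmod G <= k * Cmod F) ->
  0 <= t < r ^ 2 ->
  ex_series (fun n => Cmod (c (S n)) ^ 2 * t ^ n) /\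
  ex_series (fun n => Cmod (d (S n)) ^ 2 * t ^ n) /\
  Series (fun n => Cmod (d (S n)) ^ 2 * t ^ n)
  <= k ^ 2 * Series (fun n => Cmod (c (S n)) ^ 2 * t ^ n).
Proof.
intros Hr Hk Hf Hg Hle Ht.
set (e := fun n => k ^ 2 * Cmod (c (S n)) ^ 2 - Cmod (d (S n)) ^ 2).
(* Both series of squares converge at a point [y > x], hence so does their combination; its terms at
   [y] are then bounded and its radius is at least [y]. *)
assert (HC : forall x, 0 <= x < r ^ 2 -> Rbar_lt x (CV_radius e)).
{ intros x Hx. set (y := (x + r ^ 2) / 2).
  assert (Hy : 0 <= y < r ^ 2) by (unfold y; lra).
  apply Rbar_lt_le_trans with y; [simpl; unfold y; lra|].
  assert (Rbar_lt y (CV_radius (fun n => Cmod (c (S n)) ^ 2))) as H1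
    by (now apply Cpseries_sq_CV_radius with r f).
  assert (Rbar_lt y (CV_radius (fun n => Cmod (d (S n)) ^ 2))) as H2
    by (now apply Cpseries_sq_CV_radius with r g).
  apply ex_series_CV in H1; [|tauto]. apply ex_series_CV in H2; [|tauto].
  assert (H3 : ex_series (fun n => e n * y ^ n)).
  { apply (ex_series_scal (V := R_NormedModule) (k ^ 2)) in H1.
    pose proof (ex_series_minus (V := R_NormedModule) _ _ H1 H2) as H3.
    apply ex_series_ext with (2 := H3). intros n. unfold e.
    change (k ^ 2 * (Cmod (c (S n)) ^ 2 * y ^ n) - Cmod (d (S n)) ^ 2 * y ^ n
      = (k ^ 2 * Cmod (c (S n)) ^ 2 - Cmod (d (S n)) ^ 2) * y ^ n). ring. }
  destruct (filterlim_bounded (V := R_NormedModule) (fun n => e n * y ^ n)) as [M HM].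
  { exists 0. apply (ex_series_lim_0 _ H3). }
  apply (proj1 (CV_radius_bounded e)). exists M. exact HM. }
(* Each of the two nested calls removes one factor [INR (S n)]; the innermost series, weighted by
   its square, is nonnegative at [y = (sqrt y)^2] by Parseval. *)
assert (P : 0 <= PSeries e t).
{ apply (PSeries_antiderivative_nonneg e (r ^ 2)); trivial. intros x Hx.
  apply (PSeries_antiderivative_nonneg (fun n => INR (S n) * e n) (r ^ 2)); trivial.
  - intros y Hy. change (Rbar_lt y (CV_radius (PS_derive (PS_incr_1 e)))).
    rewrite CV_radius_derive, CV_radius_incr_1. now apply HC.
  - intros y Hy. rewrite <- (pow2_sqrt y) by tauto.
    apply derivative_parseval_le with r f g; trivial.
    split; [apply sqrt_pos|]. rewrite <- (sqrt_pow2 r) by lra. apply sqrt_lt_1; lra. }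
assert (E1 : ex_series (fun n => Cmod (c (S n)) ^ 2 * t ^ n)).
{ apply (ex_series_CV (fun n => Cmod (c (S n)) ^ 2)); [tauto|].
  now apply Cpseries_sq_CV_radius with r f. }
assert (E2 : ex_series (fun n => Cmod (d (S n)) ^ 2 * t ^ n)).
{ apply (ex_series_CV (fun n => Cmod (d (S n)) ^ 2)); [tauto|].
  now apply Cpseries_sq_CV_radius with r g. }
repeat split; trivial.
unfold PSeries in P.
rewrite (Series_ext _ (fun n => k ^ 2 * (Cmod (c (S n)) ^ 2 * t ^ n) -
   Cmod (d (S n)) ^ 2 * t ^ n)) in P by (intros n; unfold e; ring).
rewrite Series_minus, Series_scal_l in P; trivial; [lra|].
now apply (ex_series_scal (V := R_NormedModule)).
Qed.

(** * The Bohr inequality up to the radius [1 / (2 k + 3)] *)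

Lemma Series_geom_scal (x q : R) : 0 <= q < 1 ->
  ex_series (fun n => x * q ^ n) /\ Series (fun n => x * q ^ n) = x / (1 - q).
Proof.
intros Hq. assert (Rabs q < 1) by (rewrite Rabs_pos_eq; lra). split.
- apply (ex_series_scal (V := R_NormedModule)). eexists; now apply is_series_geom.
- rewrite Series_scal_l, Series_geom by trivial. reflexivity.
Qed.

(* AM-GM in the form 2 B <= B^2 / l + l, optimal at l = L. *)
Lemma Series_le_of_sq (B : nat -> R) (L q : R) :
  0 <= q < 1 -> 0 <= L -> (forall n, 0 <= B n) ->
  ex_series (fun n => B n ^ 2 * q ^ n) ->
  Series (fun n => B n ^ 2 * q ^ n) <= L ^ 2 / (1 - q) ->
  ex_series (fun n => B n * q ^ n) /\ Series (fun n => B n * q ^ n) <= L / (1 - q).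
Proof.
intros Hq HL HB He HS.
assert (Q : forall n, 0 <= q ^ n) by (intros; apply pow_le; tauto).
assert (A : forall l, 0 < l -> forall n,
   0 <= B n * q ^ n <= / (2 * l) * (B n ^ 2 * q ^ n) + l / 2 * q ^ n).
{ intros l Hl n. split; [now apply Rmult_le_pos|].
  apply Rmult_le_reg_l with (2 * l); [lra|].
  replace (2 * l * (/ (2 * l) * (B n ^ 2 * q ^ n) + l / 2 * q ^ n)) with
    ((B n ^ 2 + l ^ 2) * q ^ n) by (field; lra).
  replace (2 * l * (B n * q ^ n)) with (2 * l * B n * q ^ n) by ring.
  apply Rmult_le_compat_r; trivial. pose proof (pow2_ge_0 (B n - l)). nra. }
assert (E : forall l, 0 < l ->
   ex_series (fun n => / (2 * l) * (B n ^ 2 * q ^ n) + l / 2 * q ^ n)).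
{ intros l Hl. apply (ex_series_plus (V := R_NormedModule)).
  - now apply (ex_series_scal (V := R_NormedModule)).
  - now apply Series_geom_scal. }
split.
{ apply ex_series_nonneg_le with (1 := A 1 Rlt_0_1). apply E, Rlt_0_1. }
apply le_epsilon. intros eps Heps.
(* Positive even when [L = 0], and [l / (1 - q)] exceeds [L / (1 - q)] by exactly [eps]. *)
set (l := L + eps * (1 - q)).
assert (Hl : 0 < l) by (unfold l; nra).
eapply Rle_trans; [apply Series_le; [apply (A l Hl)|now apply E]|].
rewrite Series_plus.
2:{ now apply (ex_series_scal (V := R_NormedModule)). }
2:{ now apply Series_geom_scal. }
rewrite Series_scal_l, (proj2 (Series_geom_scal _ _ Hq)).
replace (L / (1 - q) + eps) with (l / (1 - q)) by (unfold l; field; lra).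
assert (HS' : Series (fun n => B n ^ 2 * q ^ n) <= l ^ 2 / (1 - q)).
{ eapply Rle_trans; [exact HS|]. apply Rmult_le_compat_r.
  - left; apply Rinv_0_lt_compat; lra.
  - apply pow_incr. unfold l. nra. }
apply Rle_trans with (/ (2 * l) * (l ^ 2 / (1 - q)) + l / 2 / (1 - q)).
- apply Rplus_le_compat_r, Rmult_le_compat_l; trivial.
  left; apply Rinv_0_lt_compat; lra.
- right; field; lra.
Qed.

Lemma Cseries_decr_1 (c : nat -> C) (l : C) :
  is_series (V := C_NormedModule) (fun n => c (S n)) (l - c 0%nat)%C ->
  is_series (V := C_NormedModule) c l.
Proof. exact (is_series_decr_1 (V := C_NormedModule) c l). Qed.

Lemma Cseries_incr_1 (c : nat -> C) (l : C) :
  is_series (V := C_NormedModule) c (l + c 0%nat)%C ->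
  is_series (V := C_NormedModule) (fun n => c (S n)) l.
Proof. exact (is_series_incr_1 (V := C_NormedModule) c l). Qed.

(** With constant coefficient 0, the series of [g], which starts at [n = 1], becomes a full power
    series to which [Cpseries_on] applies. *)
Definition drop_const (b : nat -> C) (n : nat) : C :=
  match n with O => RtoC 0 | S _ => b n end.

Lemma Cseries_drop_const (b : nat -> C) (u l : C) :
  is_series (V := C_NormedModule) (fun n => b (S n) * u ^ S n)%C l ->
  is_series (V := C_NormedModule) (fun n => drop_const b n * u ^ n)%C l.
Proof.
intros H. apply Cseries_decr_1.
replace (l - drop_const b 0 * u ^ 0)%C with l by (simpl; ring). exact H.
Qed.

Lemma Omega_shift (gamma : R) (u : C) :
  Cmod u < 1 / (1 - gamma) <-> Omega gamma (u - RtoC (cshift gamma))%C.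
Proof.
unfold Omega. replace (u - cshift gamma + cshift gamma)%C with u by ring. tauto.
Qed.

Lemma bohr_bound (gamma k rho : R) (h g : C -> C) (a b : nat -> C) :
  gamma < 1 -> 0 <= k -> admissible gamma k h g a b ->
  0 <= rho -> rho <= 1 / (2 * k + 3) -> bohr_ineq gamma rho a b.
Proof.
intros Hg1 Hk [_ [_ [Hh1 [Ha [Hb Hd]]]]] Hr0 Hr1.
set (r := 1 / (1 - gamma)) in *.
assert (Hr : 0 < r) by (apply Rdiv_lt_0_compat; lra).
set (s := RtoC (cshift gamma)) in *.
set (f := fun u => h (u - s)%C). set (G := fun u => g (u - s)%C).
assert (Hf : Cpseries_on r a f).
{ intros u Hu. specialize (Ha _ (proj1 (Omega_shift gamma u) Hu)).
  refine (Cseries_ext _ _ _ _ Ha). intros n. cbv beta. fold s.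
  now replace (u - s + s)%C with u by ring. }
assert (HG : Cpseries_on r (drop_const b) G).
{ intros u Hu. apply Cseries_drop_const.
  specialize (Hb _ (proj1 (Omega_shift gamma u) Hu)).
  refine (Cseries_ext _ _ _ _ Hb). intros n. cbv beta. fold s.
  now replace (u - s + s)%C with u by ring. }
assert (Hfb : forall u, Cmod u < r -> Cmod (f u) <= 1).
{ intros u Hu. apply Hh1. now apply (proj1 (Omega_shift gamma u)). }
assert (Hdom : forall u F1 G1, Cmod u < r ->
  is_series (V := C_NormedModule) (fun n => (INR (S n) * a (S n)) * u ^ n)%C F1 ->
  is_series (V := C_NormedModule) (fun n => (INR (S n) * drop_const b (S n)) * u ^ n)%C G1 ->
  Cmod G1 <= k * Cmod F1).
{ intros u F1 G1 Hu HF1 HG1. apply (Hd (u - s)%C).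
  - now apply (proj1 (Omega_shift gamma u)).
  - apply (is_Cderive_Cpseries s r a f); trivial;
      replace (u - s + s)%C with u by ring; trivial.
    intros y _. unfold f. f_equal. ring.
  - apply (is_Cderive_Cpseries s r (drop_const b) G); trivial;
      replace (u - s + s)%C with u by ring; trivial.
    intros y _. unfold G. f_equal. ring. }
assert (Hrho : rho < 1).
{ eapply Rle_lt_trans; [exact Hr1|]. apply Rmult_lt_reg_r with (2 * k + 3); [lra|].
  unfold Rdiv. rewrite Rmult_assoc, Rinv_l; lra. }
assert (Hq : 0 <= rho < 1) by lra.
assert (Pr : forall n, 0 <= rho ^ n) by (intros; now apply pow_le).
(* Moduli of the coefficients after rescaling [Omega] to the unit disk, as
   [1 / (1 - gamma)^n = r^n]. *)
set (A := fun n => Cmod (a n) / (1 - gamma) ^ n).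
set (B := fun n => Cmod (b n) / (1 - gamma) ^ n).
assert (Norm : forall (c : nat -> C) n, Cmod (c n) / (1 - gamma) ^ n = Cmod (c n) * r ^ n).
{ intros c n. unfold r. unfold Rdiv. rewrite Rmult_1_l, pow_inv. reflexivity. }
assert (A0 : A 0%nat = Cmod (a 0%nat)) by (unfold A; simpl; field).
assert (HA0 : 0 <= A 0%nat) by (rewrite A0; apply Cmod_ge_0).
assert (HA1 : A 0%nat <= 1).
{ rewrite A0. exact (proj1 (bounded_coeff_le r a f 1 Hr Hf Hfb (Nat.lt_0_1))). }
set (D := 1 - A 0%nat ^ 2). assert (HD : 0 <= D) by (unfold D; nra).
assert (HA : forall n, 0 <= A (S n) <= D).
{ intros n. unfold D. rewrite A0. unfold A. rewrite Norm. split.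
  - apply Rmult_le_pos; [apply Cmod_ge_0|apply pow_le; lra].
  - apply (bounded_coeff_le r a f (S n) Hr Hf Hfb). lia. }
assert (HB : forall n, 0 <= B (S n)).
{ intros n. unfold B. rewrite Norm.
  apply Rmult_le_pos; [apply Cmod_ge_0|apply pow_le; lra]. }
assert (SA : ex_series (fun n => A (S n) * rho ^ n)).
{ apply ex_series_nonneg_le with (fun n => D * rho ^ n).
  - intros n; split; [apply Rmult_le_pos; [apply HA|trivial]|].
    apply Rmult_le_compat_r; [trivial|apply HA].
  - now apply Series_geom_scal. }
assert (SAle : Series (fun n => A (S n) * rho ^ n) <= D / (1 - rho)).
{ rewrite <- (proj2 (Series_geom_scal D rho Hq)). apply Series_le.
  - intros n; split; [apply Rmult_le_pos; [apply HA|trivial]|].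
    apply Rmult_le_compat_r; [trivial|apply HA].
  - now apply Series_geom_scal. }
assert (HB2 : ex_series (fun n => B (S n) ^ 2 * rho ^ n) /\
  Series (fun n => B (S n) ^ 2 * rho ^ n) <= (k * D) ^ 2 / (1 - rho)).
(* At squared radius [r^2 rho], which is below [r^2], the rescaled squares carry the weight [rho^n]
   rather than [rho^(2 n)]. This is the weight that the Cauchy-Schwarz step requires. *)
{ destruct (coeff_sq_domination r k (r ^ 2 * rho) a (drop_const b) f G Hr Hk Hf HG Hdom)
    as [E1 [E2 E3]].
  { assert (0 < r ^ 2) by nra. nra. }
  assert (Q : forall (c : nat -> C) n, (Cmod (c (S n)) / (1 - gamma) ^ S n) ^ 2 * rho ^ n =
    r ^ 2 * (Cmod (c (S n)) ^ 2 * (r ^ 2 * rho) ^ n)).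
  { intros c n. rewrite Norm, !Rpow_mult_distr, <- !pow_mult, (Nat.mul_comm 2 n).
    replace (S n * 2)%nat with (2 + n * 2)%nat by lia. rewrite pow_add. ring. }
  apply (Rmult_le_compat_l (r ^ 2)) in E3; [|apply pow2_ge_0].
  rewrite <- Rmult_assoc, (Rmult_comm (r ^ 2) (k ^ 2)), Rmult_assoc, <- !Series_scal_l in E3.
  split.
  - apply (ex_series_scal (V := R_NormedModule) (r ^ 2)) in E2.
    apply ex_series_ext with (2 := E2). intros n. unfold B. rewrite (Q b). reflexivity.
  - apply Rle_trans with (k ^ 2 * (D ^ 2 / (1 - rho))); [|right; field; lra].
    rewrite (Series_ext (fun n => B (S n) ^ 2 * rho ^ n) _ (fun n => Q b n)).
    eapply Rle_trans; [exact E3|].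
    rewrite Series_scal_l. apply Rmult_le_compat_l; [apply pow2_ge_0|].
    rewrite <- (proj2 (Series_geom_scal (D ^ 2) rho Hq)). apply Series_le.
    + intros n. rewrite <- (Q a). fold (A (S n)). split.
      * apply Rmult_le_pos; [apply pow2_ge_0|trivial].
      * apply Rmult_le_compat_r; trivial. apply pow_incr, HA.
    + now apply Series_geom_scal. }
destruct HB2 as [SB2 SB2le].
assert (HkD : 0 <= k * D) by now apply Rmult_le_pos.
destruct (Series_le_of_sq (fun n => B (S n)) (k * D) rho Hq HkD HB SB2 SB2le) as [SB SBle].
assert (SA' : ex_series (fun n => A (S n) * rho ^ S n)).
{ apply (ex_series_scal (V := R_NormedModule) rho) in SA.
  apply ex_series_ext with (2 := SA). intros n.
  change (rho * (A (S n) * rho ^ n) = A (S n) * rho ^ S n). simpl; ring. }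
assert (SB' : ex_series (fun n => B (S n) * rho ^ S n)).
{ apply (ex_series_scal (V := R_NormedModule) rho) in SB.
  apply ex_series_ext with (2 := SB). intros n.
  change (rho * (B (S n) * rho ^ n) = B (S n) * rho ^ S n). simpl; ring. }
assert (SA0 : ex_series (fun n => A n * rho ^ n)) by now apply ex_series_incr_1.
split; [exact SA0|]. split; [exact SB'|].
change (Series (fun n => A n * rho ^ n) + Series (fun n => B (S n) * rho ^ S n) <= 1).
rewrite Series_incr_1 by trivial.
rewrite (Series_ext (fun n => A (S n) * rho ^ S n) (fun n => rho * (A (S n) * rho ^ n)))
  by (intros n; simpl; ring).
rewrite (Series_ext (fun n => B (S n) * rho ^ S n) (fun n => rho * (B (S n) * rho ^ n)))
  by (intros n; simpl; ring).
rewrite !Series_scal_l.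
apply (Rmult_le_compat_l rho) in SAle; [|trivial].
apply (Rmult_le_compat_l rho) in SBle; [|trivial].
set (q := rho / (1 - rho)).
assert (Hq0 : 0 <= q) by (apply Rdiv_le_0_compat; lra).
(* The origin of the Bohr radius: [rho (2 k + 3) <= 1] is the same as [2 (1 + k) rho <= 1 - rho]. *)
assert (Hq1 : q * (2 * (1 + k)) <= 1).
{ assert (rho * (2 * k + 3) <= 1).
  { apply (Rmult_le_compat_r (2 * k + 3)) in Hr1; [|lra].
    unfold Rdiv in Hr1. rewrite Rmult_assoc, Rinv_l in Hr1; lra. }
  apply Rmult_le_reg_r with (1 - rho); [lra|].
  replace (q * (2 * (1 + k)) * (1 - rho)) with (rho * (2 * (1 + k)))
    by (unfold q; field; lra). lra. }
replace (rho * (D / (1 - rho))) with (D * q) in SAle by (unfold q; field; lra).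
replace (rho * (k * D / (1 - rho))) with (k * D * q) in SBle by (unfold q; field; lra).
(* Writing [D = (1 - A 0) (1 + A 0)] and taking out [1 - A 0], it remains that
   [(1 + A 0) (1 + k) q <= 2 (1 + k) q <= 1]. *)
assert (D * (q * (1 + k)) <= 1 - A 0%nat); [|simpl (rho ^ 0); lra].
unfold D. replace (1 - A 0%nat ^ 2) with ((1 - A 0%nat) * (1 + A 0%nat)) by ring.
rewrite Rmult_assoc. rewrite <- (Rmult_1_r (1 - A 0%nat)) at 2.
apply Rmult_le_compat_l; [lra|].
assert (0 <= q * (1 + k)) by nra. nra.
Qed.

(** * Sharpness: the Moebius maps *)

Lemma is_series_Cgeom (q : C) : Cmod q < 1 ->
  is_series (V := C_NormedModule) (fun n => q ^ n)%C (/ (1 - q))%C.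
Proof.
intros Hq.
assert (Hn : (1 - q)%C <> 0).
{ intros E.
  assert (q = RtoC 1) by (transitivity (1 - (1 - q))%C; [ring|rewrite E; ring]).
  subst q. rewrite Cmod_1 in Hq. lra. }
apply Cseries_of_lim.
assert (L : is_lim_seq (fun n => Cmod q ^ n * Cmod (/ (1 - q))%C) (0 * Cmod (/ (1 - q))%C)).
{ apply is_lim_seq_mult'; [|apply is_lim_seq_const].
  apply is_lim_seq_geom. rewrite Rabs_pos_eq; [trivial|apply Cmod_ge_0]. }
rewrite Rmult_0_l in L.
apply is_lim_seq_ext with (2 := L). intros n.
rewrite <- Cmod_pow, <- Cmod_mult, <- (Cmod_opp (_ * _)). f_equal.
assert (E : (Csum (fun n => q ^ n)%C n * (1 - q))%C = (1 - q ^ n)%C).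
{ clear L. induction n as [|n IH]; [simpl; ring|].
  cbn [Csum Cpow]. rewrite Cmult_plus_distr_r, IH. ring. }
replace (Csum (fun n => q ^ n)%C n) with ((1 - q ^ n) / (1 - q))%C by (rewrite <- E; field; trivial).
field; trivial.
Qed.

(* Coefficients of (p - w) / (1 - p w), where w = e u. *)
Definition mobius_coeff (p e : R) (n : nat) : C :=
  match n with O => RtoC p | S m => RtoC (- (1 - p ^ 2) * p ^ m * e ^ S m) end.

Definition mobius (p : R) (w : C) : C := ((p - w) / (1 - p * w))%C.

Lemma mobius_den_neq0 (p : R) (w : C) : 0 <= p < 1 -> Cmod w < 1 -> (1 - p * w)%C <> 0.
Proof.
intros Hp Hw E.
assert (E' : (p * w)%C = RtoC 1).
{ transitivity (1 - (1 - p * w))%C; [ring|rewrite E; ring]. }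
apply (f_equal Cmod) in E'. rewrite Cmod_mult, Cmod_R, Cmod_1, Rabs_pos_eq in E' by tauto.
pose proof (Cmod_ge_0 w). nra.
Qed.

(** The identity [|1 - p w|^2 - |p - w|^2 = (1 - p^2) (1 - |w|^2)]. *)
Lemma Cmod_mobius_le (p : R) (w : C) : 0 <= p < 1 -> Cmod w < 1 -> Cmod (mobius p w) <= 1.
Proof.
intros Hp Hw. pose proof (mobius_den_neq0 p w Hp Hw) as Hn. unfold mobius.
rewrite Cmod_div by trivial. apply Cmod_gt_0 in Hn.
apply Rmult_le_reg_r with (Cmod (1 - p * w)); [trivial|].
unfold Rdiv. rewrite Rmult_assoc, Rinv_l, Rmult_1_r, Rmult_1_l by lra.
apply Rsqr_incr_0; [|apply Cmod_ge_0|lra]. rewrite !Rsqr_pow2, !Cmod2_alt.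
assert (Cmod w ^ 2 < 1) by (pose proof (Cmod_ge_0 w); nra).
rewrite Cmod2_alt in H. assert (Hp2 : 0 <= 1 - p ^ 2) by nra.
destruct w as [x y]. unfold Re, Im in *; simpl in *.
assert (0 <= (1 - p * (p * 1)) * (1 - (x * (x * 1) + y * (y * 1)))) by (apply Rmult_le_pos; lra).
lra.
Qed.

(** Apart from its constant term the map is geometric: [mobius p w - p = - (1 - p^2) w / (1 - p
    w)]. *)
Lemma mobius_series (p e : R) (u : C) : 0 <= p < 1 -> Cmod (e * u)%C < 1 ->
  is_series (V := C_NormedModule) (fun n => mobius_coeff p e n * u ^ n)%C (mobius p (e * u)).
Proof.
intros Hp Hu. set (w := (e * u)%C) in *.
pose proof (mobius_den_neq0 p w Hp Hu) as Hn.
apply Cseries_decr_1.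
assert (Hq : Cmod (p * w) < 1).
{ rewrite Cmod_mult, Cmod_R, Rabs_pos_eq by tauto. pose proof (Cmod_ge_0 w). nra. }
pose proof (Cseries_scal (- (1 - p ^ 2) * w)%C _ _ (is_series_Cgeom _ Hq)) as S1.
replace (mobius p w - mobius_coeff p e 0 * u ^ 0)%C
  with (- (1 - p ^ 2) * w * / (1 - p * w))%C.
- refine (Cseries_ext _ _ _ _ S1). intros n. cbn [mobius_coeff].
  unfold w. rewrite !RtoC_mult, RtoC_opp, RtoC_minus, !RtoC_pow. cbn [Cpow].
  rewrite !Cpow_mult_l. ring.
- unfold mobius, mobius_coeff. cbn [Cpow]. field; trivial.
Qed.

Definition mobius_g_coeff (k p e : R) (n : nat) : C := (k * mobius_coeff p e n)%C.

(** Since [g = k (h - p)], the derivatives satisfy [g' = k h'], so the dilatation bound holds with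
    equality. The linear map [w] carries [Omega] onto the unit disk. *)
Lemma mobius_admissible (gamma k p : R) : gamma < 1 -> 0 <= k -> 0 <= p < 1 ->
  let w := fun z => ((1 - gamma)%R * (z + cshift gamma))%C in
  admissible gamma k (fun z => mobius p (w z)) (fun z => k * (mobius p (w z) - p))%C
    (mobius_coeff p (1 - gamma)) (mobius_g_coeff k p (1 - gamma)).
Proof.
intros Hg Hk Hp w. set (r := 1 / (1 - gamma)). set (s := RtoC (cshift gamma)).
set (c := mobius_coeff p (1 - gamma)). set (d := mobius_g_coeff k p (1 - gamma)).
set (f := fun u => mobius p ((1 - gamma)%R * u)).
set (F := fun u => (k * (f u - p))%C).
assert (Hw : forall u, Cmod u < r -> Cmod ((1 - gamma)%R * u) < 1).
{ intros u Hu. rewrite Cmod_mult, Cmod_R, Rabs_pos_eq by lra.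
  apply (Rmult_lt_compat_l (1 - gamma)) in Hu; [|lra].
  replace ((1 - gamma) * r) with 1 in Hu by (unfold r; field; lra). exact Hu. }
assert (Hf : Cpseries_on r c f).
{ intros u Hu. apply mobius_series; auto. }
assert (Hg0 : forall u, Cmod u < r ->
  is_series (V := C_NormedModule) (fun n => d (S n) * u ^ S n)%C (F u)).
{ intros u Hu.
  (* The series of [k f], with its constant term [k p] removed, is that of [F]. *)
  apply (Cseries_incr_1 (fun n => d n * u ^ n)%C).
  pose proof (Cseries_scal k _ _ (Hf u Hu)) as S1.
  replace (F u + d 0%nat * u ^ 0)%C with (k * f u)%C.
  - refine (Cseries_ext _ _ _ _ S1). intros n. unfold d, mobius_g_coeff. fold c. cbv beta. ring.
  - unfold F, d, mobius_g_coeff, mobius_coeff. simpl. ring. }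
assert (HG : Cpseries_on r (drop_const d) F).
{ intros u Hu. now apply Cseries_drop_const, Hg0. }
assert (Dh : forall z l, Omega gamma z ->
  is_series (V := C_NormedModule) (fun n => (INR (S n) * c (S n)) * (z + s) ^ n)%C l ->
  is_Cderive (fun z => mobius p (w z)) z l /\
  is_Cderive (fun z => k * (mobius p (w z) - p))%C z (k * l)%C).
{ intros z l Hz Hl. split.
  - now apply (is_Cderive_Cpseries s r c f).
  - apply (is_Cderive_Cpseries s r (drop_const d) F); trivial.
    refine (Cseries_ext _ _ _ _ (Cseries_scal k _ _ Hl)). intros n. cbv beta.
    cbn [drop_const]. unfold d, mobius_g_coeff. fold c. ring. }
assert (Ex : forall z, Omega gamma z -> exists l,
  is_series (V := C_NormedModule) (fun n => (INR (S n) * c (S n)) * (z + s) ^ n)%C l).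
{ intros z Hz. now apply (Cpseries_derive_ex r c f). }
repeat split.
- intros z Hz. destruct (Ex z Hz) as [l Hl]. exists l. now apply Dh.
- intros z Hz. destruct (Ex z Hz) as [l Hl]. exists (k * l)%C. now apply Dh.
- intros z Hz. apply Cmod_mobius_le; trivial. now apply Hw.
- intros z Hz. now apply Hf.
- intros z Hz. now apply Hg0.
- intros z dh dg Hz H1 H2. destruct (Ex z Hz) as [l Hl]. destruct (Dh z l Hz Hl) as [D1 D2].
  apply is_C_derive_unique in H1. apply is_C_derive_unique in H2.
  apply is_C_derive_unique in D1. apply is_C_derive_unique in D2.
  rewrite <- H1, <- H2, D1, D2, Cmod_mult, Cmod_R, Rabs_pos_eq; [lra|trivial].
Qed.

(** The Bohr sum equals [p + (1 + k) (1 - p^2) rho / (1 - p rho)]. Multiplying its comparison with 1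
    by [1 - p rho] and dividing by [1 - p] leaves exactly the last numerical hypothesis, which tends
    to [1 < (2 k + 3) rho] as [p] tends to 1. *)
Lemma mobius_bohr_fail (gamma k p rho : R) : gamma < 1 -> 0 <= k -> 0 <= p < 1 ->
  0 <= rho < 1 -> 1 < (1 + k) * (1 + p) * rho + p * rho ->
  ~ bohr_ineq gamma rho (mobius_coeff p (1 - gamma)) (mobius_g_coeff k p (1 - gamma)).
Proof.
intros Hg Hk Hp Hr Hbig [E1 [E2 E3]].
assert (Hpr : 0 <= p * rho < 1) by nra.
assert (N : forall n, Cmod (mobius_coeff p (1 - gamma) (S n)) / (1 - gamma) ^ S n * rho ^ S n
  = (1 - p ^ 2) * rho * (p * rho) ^ n).
{ intros n. cbn [mobius_coeff]. rewrite Cmod_R, !Rabs_mult, Rabs_Ropp.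
  rewrite !Rabs_pos_eq; try (apply pow_le; lra); [|nra].
  rewrite Rpow_mult_distr. cbn [pow]. field. split; try apply pow_nonzero; lra. }
rewrite Series_incr_1 in E3 by trivial.
rewrite (Series_ext _ _ N), (proj2 (Series_geom_scal _ _ Hpr)) in E3.
rewrite (Series_ext _ (fun n => k * ((1 - p ^ 2) * rho) * (p * rho) ^ n)),
  (proj2 (Series_geom_scal _ _ Hpr)) in E3.
2:{ intros n. unfold mobius_g_coeff. rewrite Cmod_mult, Cmod_R, (Rabs_pos_eq k) by trivial.
    unfold Rdiv at 1. rewrite !Rmult_assoc, <- (Rmult_assoc (Cmod _) _ (rho ^ S n)).
    fold (Cmod (mobius_coeff p (1 - gamma) (S n)) / (1 - gamma) ^ S n).
    rewrite N. ring. }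
simpl (mobius_coeff p (1 - gamma) 0) in E3. rewrite Cmod_R, Rabs_pos_eq in E3 by tauto.
simpl (_ ^ 0) in E3.
apply (Rmult_le_compat_r (1 - p * rho)) in E3; [|lra].
replace ((p / 1 * 1 + (1 - p ^ 2) * rho / (1 - p * rho) +
      k * ((1 - p ^ 2) * rho) / (1 - p * rho)) * (1 - p * rho))
 with (p * (1 - p * rho) + (1 + k) * ((1 - p) * (1 + p)) * rho) in E3 by (field; lra).
assert (0 < (1 - p) * ((1 + k) * (1 + p) * rho + p * rho - 1)) by (apply Rmult_lt_0_compat; lra).
lra.
Qed.

Theorem theorem2p2 (gamma k : R) (hg0 : 0 <= gamma) (hg1 : gamma < 1)
  (hk0 : 0 <= k) (hk1 : k < 1) :
  (forall (h g : C -> C) (a b : nat -> C),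
     admissible gamma k h g a b ->
     forall rho, 0 <= rho -> rho <= 1 / (2 * k + 3) -> bohr_ineq gamma rho a b)
  /\
  (forall rho, 1 / (2 * k + 3) < rho -> rho < 1 ->
     exists (h g : C -> C) (a b : nat -> C),
       admissible gamma k h g a b /\ ~ bohr_ineq gamma rho a b).
Proof.
split.
- intros h g a b H rho H0 H1. now apply (bohr_bound gamma k rho h g a b).
- intros rho H0 H1.
  assert (Hr0 : 0 < rho).
  { eapply Rlt_trans; [|exact H0]. apply Rdiv_lt_0_compat; lra. }
  assert (Hr : 1 < rho * (2 * k + 3)).
  { apply (Rmult_lt_compat_r (2 * k + 3)) in H0; [|lra].
    unfold Rdiv in H0. rewrite Rmult_assoc, Rinv_l in H0; lra. }
  (* For [p = 1 - e] the quantity to compare with 1 is [(2 k + 3) rho - e (k + 2) rho]. The choice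
     makes [(2 k + 3) rho - 1 = e (2 k + 4)], which exceeds [e (k + 2) rho] because [rho < 1]. *)
  set (e := (rho * (2 * k + 3) - 1) / (2 * k + 4)).
  assert (E : e * (2 * k + 4) = rho * (2 * k + 3) - 1) by (unfold e; field; lra).
  assert (He : 0 < e) by (apply Rdiv_lt_0_compat; lra).
  assert (He1 : e < 1) by nra.
  set (p := 1 - e).
  exists (fun z => mobius p ((1 - gamma)%R * (z + cshift gamma))%C).
  exists (fun z => k * (mobius p ((1 - gamma)%R * (z + cshift gamma)) - p))%C.
  exists (mobius_coeff p (1 - gamma)), (mobius_g_coeff k p (1 - gamma)).
  split.
  + apply mobius_admissible; trivial. unfold p; lra.
  + apply mobius_bohr_fail; trivial; unfold p; try lra. nra.
Qed.
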